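(* Let $X$ be a finite set of variables and let $f:\{0,1\}^{X}\to\{0,1\}$ be computable by a connected algebraic tensor network $\mathcal{N}$ over $X$ of treewidth $t$, rank $r$, and algebraic degree $d$. Let $Y\subseteq X$ and let $l$ be the number of $Y$-tensors in $\mathcal{N}$. Then $N_f(Y)\le \exp\left(2^{O(r\cdot t)}\cdot |Y|^{d+1}\cdot l\cdot\log l\right)$.
   Context: $N_f(Y)$ denotes the number of distinct functions $\{0,1\}^Y\to\{0,1\}$ obtained from $f$ by fixing all variables in $X\setminus Y$ to values in $\{0,1\}$. A polynomial constrains $y$ if $y$ occurs in a nonzero term; an algebraic tensor over $X$ is a $Y$-tensor if some entry polynomial constrains some $y\in Y$. Let $\Pi=\{|0\rangle\langle0|,|0\rangle\langle1|,|1\rangle\langle0|,|1\rangle\langle1|\}$. An algebraic tensor over $X$ with index set $\mathcal{I}=\{i_1,\dots,i_k\}$ (positive integers) is an array indexed by $\Pi^k$ with entries in $\mathbb{C}[X]$; rank $=|\mathcal{I}|$, algebraic degree $=$ max degree of an entry. An algebraic tensor network $\mathcal{N}=[g_1,\dots,g_m]$ is a sequence of such tensors in which every occurring index lies in exactly two index sets; rank $=\max$ rank, algebraic degree $=\max$ degree. $G(\mathcal{N})$: vertex per tensor, edge per index joining the two tensors containing it (multigraph); connectedness and treewidth of $\mathcal{N}$ refer to $G(\mathcal{N})$. Contracting $g,g'$ sums the product of entries over $\Pi$-values of shared indices, giving a tensor on the symmetric difference of index sets; contracting all tensors of a connected network yields a polynomial $g_{\mathcal{N}}=p_1+ip_2$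 ($p_1,p_2$ real polynomials), independent of order; the value is $\mathcal{V}_{\mathcal{N}}=\sqrt{p_1^2+p_2^2}$. $\mathcal{N}$ computes $f$ if $\mathcal{V}_{\mathcal{N}}(\alpha)>1/2$ when $f(\alpha)=1$ and $<1/2$ when $f(\alpha)=0$, for all Boolean $\alpha$.
   Formalization: In the bound, l, |Y| and r·t are read as max(l,2) (also inside the logarithm), max(|Y|,1) and max(r·t,1), because for l ≤ 1 the literal bound is false or undefined (log 1 = 0); for l ≥ 2 the bound is exactly as stated. *)

(* Defs.v *)
From mathcomp Require Import all_boot all_order all_algebra.
From mathcomp Require Import finmap mpoly complex.

Set Implicit Arguments.
Unset Strict Implicit.
Unset Printing Implicit Defensive.

Import GRing.Theory Num.Theory.

Local Open Scope ring_scope.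

(* Reads f(beta, -) as a function on {0,1}^Y; only the values of beta outside
   Y are used. *)
Definition subfun (X : finType) (f : {ffun X -> bool} -> bool) (Y : {set X})
    (beta : {ffun X -> bool}) : {ffun {ffun {x : X | x \in Y} -> bool} -> bool} :=
  [ffun a : {ffun {x : X | x \in Y} -> bool} =>
     f [ffun x => if insub x is Some y then a y else beta x]].

Definition nb_subfun (X : finType) (f : {ffun X -> bool} -> bool)
    (Y : {set X}) : nat :=
  #|[set subfun f Y beta | beta : {ffun X -> bool}]|.

Record mgraph := MGraph {
  vertex : finType;
  edge : finType;
  ends : edge -> {set vertex}
}.

Definition adjacent (G : mgraph) : rel (vertex G) :=
  fun u v => [exists e : edge G, (u \in ends e) && (v \in ends e)].

(* The graph without vertices is not connected. *)
Definition connected_mgraph (G : mgraph) : Prop :=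
  (0 < #|vertex G|)%N /\ forall u v : vertex G, connect (@adjacent G) u v.

Definition is_tree (T : finType) (e : rel T) : Prop :=
  [/\ (0 < #|T|)%N,
      ssrbool.symmetric e /\ irreflexive e,
      forall a b : T, connect e a b
    & forall c : seq T, ucycle e c -> (size c <= 2)%N].

Definition tree_decomposition (G : mgraph) (T : finType) (e : rel T)
    (bag : T -> {set vertex G}) : Prop :=
  [/\ is_tree e,
      forall v : vertex G, exists a : T, v \in bag a,
      forall x : edge G, exists a : T, ends x \subset bag a
    & forall (v : vertex G) (a b : T), v \in bag a -> v \in bag b ->
        connect [rel c d | [&& e c d, v \in bag c & v \in bag d]] a b].

Definition width (G : mgraph) (T : finType) (bag : T -> {set vertex G}) : nat :=
  (\max_(a : T) #|bag a|).-1.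

Definition has_treewidth (G : mgraph) (t : nat) : Prop :=
  (exists (T : finType) (e : rel T) (bag : T -> {set vertex G}),
     tree_decomposition e bag /\ width bag = t) /\
  (forall (T : finType) (e : rel T) (bag : T -> {set vertex G}),
     tree_decomposition e bag -> (t <= width bag)%N).

(* The pair (a, b) stands for the matrix unit |a><b|. *)
Definition Pi : finType := (bool * bool)%type.

(* The variable x : X is the indeterminate of number enum_rank x. *)
Definition xpoly (R : rcfType) (X : finType) := {mpoly R[i][#|X|]}.

Definition constrains (R : rcfType) (X : finType) (p : xpoly R X) (y : X) : bool :=
  has (fun m : 'X_{1..#|X|} => m (enum_rank y) != 0%N) (msupp p).

(* The total degree; the zero polynomial gets degree 0. *)
Definition deg (R : rcfType) (X : finType) (p : xpoly R X) : nat :=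
  (msize p).-1.

(* An entry is addressed by a map from the index set to Pi, i.e. by an element
   of Pi^k once the index set is listed in increasing order. *)
Record tensor (R : rcfType) (X : finType) := Tensor {
  idx : {fset nat};
  entry : {ffun idx -> Pi} -> xpoly R X
}.

Definition tensor_rank (R : rcfType) (X : finType) (g : tensor R X) : nat :=
  #|` idx g|.

Definition tensor_degree (R : rcfType) (X : finType) (g : tensor R X) : nat :=
  \max_(s : {ffun idx g -> Pi}) deg (entry s).

Definition Y_tensor (R : rcfType) (X : finType) (Y : {set X})
    (g : tensor R X) : bool :=
  [exists s : {ffun idx g -> Pi}, [exists y in Y, constrains (entry s) y]].

(* The values prescribed by s on D and by u on K; the final default is never
   used at an index of D `|` K. *)
Definition combine (D K : {fset nat}) (s : {ffun D -> Pi}) (u : {ffun K -> Pi})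
    (i : nat) : Pi :=
  if insub i is Some j then s j
  else if insub i is Some j then u j else (false, false).

Definition restr_idx (I : {fset nat}) (w : nat -> Pi) : {ffun I -> Pi} :=
  [ffun j : I => w (val j)].

Definition contract (R : rcfType) (X : finType) (g g' : tensor R X) :
    tensor R X :=
  @Tensor R X ((idx g `\` idx g') `|` (idx g' `\` idx g))%fset
    (fun s => \sum_(u : {ffun (idx g `&` idx g')%fset -> Pi})
       entry (restr_idx (idx g) (combine s u)) *
       entry (restr_idx (idx g') (combine s u))).

Definition unit_tensor (R : rcfType) (X : finType) : tensor R X :=
  @Tensor R X fset0 (fun _ => 1).

Definition net_idx (R : rcfType) (X : finType) (m : nat)
    (N : m.-tuple (tensor R X)) : {fset nat} := (\bigcup_(g <- N) idx g)%fset.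

Definition net_graph (R : rcfType) (X : finType) (m : nat)
    (N : m.-tuple (tensor R X)) : mgraph :=
  @MGraph 'I_m (net_idx N) (fun i => [set v | val i \in idx (tnth N v)]).

Definition is_network (R : rcfType) (X : finType) (m : nat)
    (N : m.-tuple (tensor R X)) : Prop :=
  forall i : net_idx N,
    (0 < val i)%N /\ #|[set v : 'I_m | val i \in idx (tnth N v)]| = 2%N.

Definition net_rank (R : rcfType) (X : finType) (m : nat)
    (N : m.-tuple (tensor R X)) : nat := \max_(g <- N) tensor_rank g.

Definition net_degree (R : rcfType) (X : finType) (m : nat)
    (N : m.-tuple (tensor R X)) : nat := \max_(g <- N) tensor_degree g.

Definition nb_Y_tensors (R : rcfType) (X : finType) (m : nat)
    (N : m.-tuple (tensor R X)) (Y : {set X}) : nat := count (Y_tensor Y) N.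

(* In a network every index belongs to two tensors, so contracting all of them
   leaves no index: the result has exactly one entry, addressed by the unique
   map from fset0 to Pi, and the argument of entry below is that map. *)
Definition net_poly (R : rcfType) (X : finType) (m : nat)
    (N : m.-tuple (tensor R X)) : xpoly R X :=
  @entry R X (foldr (@contract R X) (unit_tensor R X) N) [ffun=> (false, false)].

Definition net_value (R : rcfType) (X : finType) (m : nat)
    (N : m.-tuple (tensor R X)) (alpha : {ffun X -> bool}) : R :=
  let x := fun j : 'I_#|X| => (nat_of_bool (alpha (enum_val j)))%:R : R in
  let p1 := map_mpoly (@complex.Re R) (net_poly N) in
  let p2 := map_mpoly (@complex.Im R) (net_poly N) in
  Num.sqrt (p1.@[x] ^+ 2 + p2.@[x] ^+ 2).

Definition computes (R : rcfType) (X : finType) (m : nat)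
    (N : m.-tuple (tensor R X)) (f : {ffun X -> bool} -> bool) : Prop :=
  forall alpha : {ffun X -> bool},
    if f alpha then 1 / 2 < net_value N alpha
    else net_value N alpha < 1 / 2.

(* Main.v *)
(* Cutting the tree of the decomposition at O(l) places partitions the tensors into
   O(l) pieces, each a single Y-tensor or free of Y-tensors, and each joined to the
   rest by at most 4rt indices. Contracted on its own, a piece becomes a tensor with at
   most 4 ^ (4rt) entries, which are polynomials of degree at most d in the Y-variables
   whose coefficients depend on the assignment outside Y. Hence p1 ^ 2 + p2 ^ 2 - 1/4,
   at each of the 2 ^ |Y| points of {0,1}^Y, is a fixed polynomial of degree O(l) in
   2 ^ O(rt) |Y| ^ d l real parameters, and a subfunction is a sign pattern of these
   2 ^ |Y| polynomials.
   Sign patterns are counted in place of Warren's theorem as follows. Let Q be the product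
   of M polynomials of degree at most D in p variables and put N = 2MD + 1. For small
   eps > 0, F = Q ^ 2 - eps sum_i x_i ^ (N + 1) is positive at a chosen point of every cell
   and negative far away, and at most 0 where Q vanishes, so it has a critical point in
   every cell. Critical points satisfy x_i ^ N = G_i(x) with deg G_i < N; modulo these
   equations every polynomial is a combination of the N ^ p monomials with all exponents
   below N, so, by interpolation, there are at most N ^ p critical points. *)
Require Import Defs.
From mathcomp Require Import all_boot all_order all_algebra.
From mathcomp Require Import finmap complex.
From mathcomp Require Import -(notations) mpoly.
From mathcomp Require Import boolp reals sequences exp.
From mathcomp Require all_classical topology normedtype derive.
From mathcomp Require Import zify ring lra.

Set Implicit Arguments.
Unset Strict Implicit.
Unset Printing Implicit Defensive.

Import Order.TTheory GRing.Theory Num.Theory.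
Import ComplexField.

(** * Tree decompositions *)

Lemma connect_invariant (T : finType) (e : rel T) (P : T -> Prop) (x y : T) :
  P x -> (forall a b, connect e x a -> e a b -> P a -> P b) ->
  connect e x y -> P y.
Proof.
move=> Px step /connectP[p]; elim/last_ind: p y => [|p z IHp] y /=.
  by move=> _ ->.
rewrite rcons_path last_rcons => /andP[ep ez] ->.
by apply: step ez (IHp _ ep erefl); apply/connectP; exists p.
Qed.

Section TreeSides.
Variables (T : finType) (e : rel T).
Hypothesis tree_e : is_tree e.

Definition cut (x y : T) : rel T :=
  [rel a b | e a b && ~~ ((a == x) && (b == y) || (a == y) && (b == x))].

(* The component of [x] once the edge [xy] is removed. As there are no loops, [side x x]
   is the whole tree, which lets one induction cover the root and the subtrees. *)
Definition side (x y : T) : {set T} := [set w | connect (cut x y) x w].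

Let e_sym : ssrbool.symmetric e. Proof. by case: tree_e => _ [? _]. Qed.
Let e_irr : irreflexive e. Proof. by case: tree_e => _ [_ ?]. Qed.

Lemma cutE x y a b : cut x y a b =
  e a b && ~~ ((a == x) && (b == y) || (a == y) && (b == x)).
Proof. by []. Qed.

Lemma cut_sym x y : ssrbool.symmetric (cut x y).
Proof.
by move=> a b; rewrite !cutE e_sym orbC (andbC (b == y)) (andbC (b == x)).
Qed.

Lemma cutC x y : cut x y =2 cut y x.
Proof. by move=> a b; rewrite !cutE orbC. Qed.

Lemma cut_connect_sym x y : connect_sym (cut x y).
Proof. by apply: sym_connect_sym; apply: cut_sym. Qed.

Lemma side_refl x y : x \in side x y.
Proof. by rewrite inE connect0. Qed.

Lemma side_id x : side x x = setT.
Proof.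
apply/setP=> w; rewrite !inE (@eq_connect _ (cut x x) e); first by case: tree_e => _ _ /(_ x w) ->.
move=> a b; rewrite cutE orbb; apply: andb_idr => eab.
by apply/negP=> /andP[/eqP ax /eqP bx]; rewrite ax bx e_irr in eab.
Qed.

(** A path from [x] to [y] that avoids the edge can be shortened to a simple one. The edge closes it
    to a cycle, which in a tree has at most two nodes, and then the path is the edge itself. *)
Lemma bridge x y : e x y -> y \notin side x y.
Proof.
move=> exy; apply/negP; rewrite inE => /connectP[p px].
case/shortenP: px => q px uq _ def_y.
case: tree_e => _ _ _ /(_ (x :: q)) acyc.
have cyc : ucycle e (x :: q).
  rewrite /ucycle uq andbT /= rcons_path -def_y e_sym exy andbT.
  by apply: sub_path px => a b /andP[].
have {acyc cyc} := acyc cyc.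
case: q px uq def_y => [|z [|? ?]] //=.
  by move=> _ _ yx; rewrite yx e_irr in exy.
by move=> + _ yz; rewrite cutE -yz !eqxx !andbF.
Qed.

Lemma side_crossing x y c c' : e x y ->
  e c c' -> c \in side x y -> c' \notin side x y -> c = x /\ c' = y.
Proof.
move=> exy ec cin c'out.
have : ~~ cut x y c c'.
  apply: contra c'out => cc'; rewrite inE in cin; rewrite inE.
  exact: connect_trans cin (connect1 cc').
rewrite cutE ec negbK => /orP[] /andP[/eqP cx /eqP c'x] //.
by move: cin; rewrite cx (negPf (bridge exy)).
Qed.

(** By [bridge], a walk from [z] that avoids the edge [xz] never reaches [x], so it avoids [xy] as
    well; one step from [x] to [z] completes it. *)
Lemma side_child x y z : e x z -> z != y -> side z x \subset side x y :\ x.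
Proof.
move=> exz zy; have ezx : e z x by rewrite e_sym.
apply/subsetP=> w wz; have xz := bridge ezx.
rewrite in_setD1; apply/andP; split; first by apply: contraNneq xz => wx; rewrite -{1}wx.
rewrite inE.
move: wz; rewrite inE.
apply: (connect_invariant (P := connect (cut x y) x)) => [|a b za ab IHa].
  apply: connect1; rewrite cutE exz /=.
  rewrite (negPf zy) andbF /=; apply/negP=> /andP[_ /eqP zx].
  by rewrite zx e_irr in exz.
apply: connect_trans IHa (connect1 _).
have zb := connect_trans za (connect1 ab).
move: (ab) => /andP[eab _]; rewrite cutE eab /=.
have /negPf-> : a != x by apply: contraNneq xz => ax; rewrite inE -{2}ax.
have /negPf-> : b != x by apply: contraNneq xz => bx; rewrite inE -{2}bx.
by rewrite andbF.
Qed.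

(** By [side_child], a common node would be joined both to [x] and to [z] without the edge [xz],
    against [bridge]. *)
Lemma side_disjoint x z z' : e x z -> e x z' -> z != z' ->
  [disjoint side z x & side z' x].
Proof.
move=> exz exz' zz'; rewrite disjoint_subset; apply/subsetP=> w wz.
rewrite inE; apply/negP=> wz'.
have := subsetP (side_child exz' (_ : z' != z)) _ wz'.
rewrite eq_sym zz' => /(_ isT); rewrite !inE => /andP[_ xw].
have /negP[] := bridge exz; rewrite inE; apply: connect_trans xw _.
by rewrite cut_connect_sym (eq_connect (cutC x z)); rewrite inE in wz.
Qed.

Lemma side_children x y w : w \in side x y -> w != x ->
  exists z, [/\ e x z, z != y & w \in side z x].
Proof.
rewrite inE => xw wx.
suff [/eqP|//] : w = x \/ exists z, [/\ e x z, z != y & w \in side z x].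
  by rewrite (negPf wx).
move: xw; apply: (connect_invariant (P := fun w => w = x \/
  exists z, [/\ e x z, z != y & w \in side z x])) => [|a b _]; first by left.
have [->|bx] := eqVneq b x; first by left.
move=> /andP[eab nab] [ax|[z [exz zy az]]]; right.
  exists b; split; [by rewrite -ax|  | exact: side_refl].
  by apply: contra nab => /eqP->; rewrite ax !eqxx.
exists z; split=> //; move: (az); rewrite !inE => zca.
apply: connect_trans zca (connect1 _); rewrite cutE eab (negPf bx) andbF /=.
apply/negP=> /andP[/eqP ax _]; move: az; rewrite ax.
have ezx : e z x by rewrite e_sym.
by apply/negP; apply: bridge.
Qed.

End TreeSides.

(** * Boundaries and disjoint unions of vertex sets *)

Definition boundary (G : mgraph) (W : {set vertex G}) : {set edge G} :=
  [set i | (ends i :&: W != set0) && ~~ (ends i \subset W)].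

Lemma boundary_setT (G : mgraph) : @boundary G setT = set0.
Proof. by apply/setP=> i; rewrite !inE subsetT andbF. Qed.

Lemma boundary_set0 (G : mgraph) : @boundary G set0 = set0.
Proof. by apply/setP=> i; rewrite [LHS]inE setI0 eqxx inE. Qed.

Lemma boundaryP (G : mgraph) (W : {set vertex G}) (i : edge G) :
  reflect (exists v u, [/\ v \in ends i, v \in W, u \in ends i & u \notin W])
          (i \in boundary W).
Proof.
rewrite inE; apply: (iffP andP) => [[/set0Pn[v /setIP[vi vW]] /subsetPn[u ui uW]]|].
  by exists v, u.
case=> v [u [vi vW ui uW]]; split; last by apply/subsetPn; exists u.
by apply/set0Pn; exists v; rewrite inE vi.
Qed.

Lemma boundary_setU (G : mgraph) (U W : {set vertex G}) :
  boundary (U :|: W) \subset boundary U :|: boundary W.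
Proof.
apply/subsetP=> i /boundaryP[v [u [vi + ui]]].
rewrite !in_setU negb_or => /orP[vU|vW] /andP[uU uW]; apply/orP; [left|right].
  by apply/boundaryP; exists v, u.
by apply/boundaryP; exists v, u.
Qed.

(** An edge that leaves [U] either leaves the union or ends in [W], and then it leaves [W] too. This
    controls what remains when [W] is taken out of a set. *)
Lemma boundary_setUl (G : mgraph) (U W : {set vertex G}) : [disjoint U & W] ->
  boundary U \subset boundary (U :|: W) :|: boundary W.
Proof.
move=> dUW; apply/subsetP=> i /boundaryP[v [u [vi vU ui uU]]]; rewrite in_setU.
have [uW|uW] := boolP (u \in W); apply/orP; [right|left]; apply/boundaryP.
  by exists u, v; split=> //; rewrite (disjointFr dUW).
by exists v, u; split=> //; rewrite inE ?vU // negb_or uU.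
Qed.

(** Empty pieces are allowed, so [n] is only an upper bound for the number of nonempty ones. The
    inductive form lets a contraction be assembled one piece at a time. *)
Inductive disjoint_union (V : finType) (good : {set V} -> Prop) :
    {set V} -> nat -> Prop :=
  | DisjointUnion0 : disjoint_union good set0 0
  | DisjointUnionS (U W : {set V}) n : good U -> [disjoint U & W] ->
      disjoint_union good W n -> disjoint_union good (U :|: W) n.+1.

Lemma disjoint_union_impl (V : finType) (good good' : {set V} -> Prop) W n :
  (forall U, good U -> good' U) -> disjoint_union good W n -> disjoint_union good' W n.
Proof.
move=> gg'; elim=> {W n} [|U W n gU dUW _ IH]; first exact: DisjointUnion0.
exact: DisjointUnionS (gg' _ gU) dUW IH.
Qed.

Lemma disjoint_union1 (V : finType) (good : {set V} -> Prop) U :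
  good U -> disjoint_union good U 1.
Proof.
move=> gU; rewrite -[U]setU0; apply: DisjointUnionS gU _ (DisjointUnion0 _).
by rewrite disjoint_sym disjoints_subset sub0set.
Qed.

Lemma disjoint_unionU (V : finType) (good : {set V} -> Prop) (U W : {set V}) m n :
  [disjoint U & W] -> disjoint_union good U m -> disjoint_union good W n ->
  disjoint_union good (U :|: W) (m + n).
Proof.
move=> + dU dW; elim: dU => [|U1 W1 k gU1 dU1 _ IH]; first by rewrite set0U.
rewrite -setUA -setI_eq0 setIUl setU_eq0 !setI_eq0 => /andP[d1 d2].
apply: DisjointUnionS (IH d2) => //.
by rewrite -setI_eq0 setIUr setU_eq0 !setI_eq0 dU1.
Qed.

Lemma disjoint_union_bigcup (V I : finType) (good : {set V} -> Prop)
    (P : {set I}) (F : I -> {set V}) (n : I -> nat) :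
  (forall i j, i \in P -> j \in P -> i != j -> [disjoint F i & F j]) ->
  (forall i, i \in P -> disjoint_union good (F i) (n i)) ->
  disjoint_union good (\bigcup_(i in P) F i) (\sum_(i in P) n i).
Proof.
have [k] := ubnP #|P|; elim: k P => // k IH P; rewrite ltnS => lePk dF gF.
have [->|[i iP]] := set_0Vmem P; first by rewrite !big_set0; apply: DisjointUnion0.
rewrite (big_setD1 i) //= (big_setD1 i (_ : i \in P)) //=.
have dFi : [disjoint F i & \bigcup_(j in P :\ i) F j].
  by apply/bigcup_disjointP => j /setD1P[ji jP]; apply: dF; rewrite // eq_sym.
apply: disjoint_unionU dFi (gF i iP) _.
apply: IH => [|a b /setD1P[_ aP] /setD1P[_ bP]|a /setD1P[_ aP]].
- by move: lePk; rewrite (cardsD1 i) iP.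
- exact: dF.
- exact: gF.
Qed.

Lemma disjoint_unionW (V : finType) (good : {set V} -> Prop) (W : {set V}) m n :
  good set0 -> m <= n -> disjoint_union good W m -> disjoint_union good W n.
Proof.
move=> g0 /subnKC <- dW; elim: (n - m) => [|k IH]; first by rewrite addn0.
rewrite addnS -[W]set0U; apply: DisjointUnionS g0 _ IH.
by rewrite disjoints_subset sub0set.
Qed.

Lemma card_bigcup_disjoint (V I : finType) (P : {set I}) (F : I -> {set V}) :
  (forall i j, i \in P -> j \in P -> i != j -> [disjoint F i & F j]) ->
  #|\bigcup_(i in P) F i| = \sum_(i in P) #|F i|.
Proof.
have [k] := ubnP #|P|; elim: k P => // k IH P; rewrite ltnS => lePk dF.
have [->|[i iP]] := set_0Vmem P; first by rewrite !big_set0 cards0.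
rewrite (big_setD1 i) //= (big_setD1 i (_ : i \in P)) //=.
have dFi : [disjoint F i & \bigcup_(j in P :\ i) F j].
  by apply/bigcup_disjointP => j /setD1P[ji jP]; apply: dF; rewrite // eq_sym.
rewrite cardsU (disjoint_setI0 dFi) cards0 subn0 IH //.
  by move: lePk; rewrite (cardsD1 i) iP.
by move=> a b /setD1P[_ aP] /setD1P[_ bP]; apply: dF.
Qed.

(** * Cutting a graph into pieces along a tree decomposition *)

Section Pieces.
Variables (G : mgraph) (T : finType) (e : rel T) (bag : T -> {set vertex G}).
Hypothesis dec : tree_decomposition e bag.
Variable K : nat.
Hypothesis bag_edges : forall x, #|[set i : edge G | ends i :&: bag x != set0]| <= K.
Variable A : {set vertex G}.

Let tree_e : is_tree e. Proof. by case: dec. Qed.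
Let e_sym : ssrbool.symmetric e. Proof. by case: tree_e => _ [? _]. Qed.
Let e_irr : irreflexive e. Proof. by case: tree_e => _ [_ ?]. Qed.

(** The factor 2 arises because a piece may be the difference of two nested sets, each with at most
    [K] boundary edges. *)
Definition good_piece (U : {set vertex G}) : Prop :=
  #|boundary U| <= K.*2 /\ ([disjoint U & A] \/ exists v, U = [set v]).

(** For an edge [xy], the vertices shared across it are left out, which makes every boundary edge
    end in [bag x :&: bag y]. With [x = y] this is the whole graph. *)
Definition inside (x y : T) : {set vertex G} :=
  [set v | [forall c, (v \in bag c) ==> (c \in side e x y)]].

Lemma insideP x y v :
  reflect (forall c, v \in bag c -> c \in side e x y) (v \in inside x y).
Proof.
rewrite inE; apply: (iffP forallP) => H c; first exact/implyP/H.
by apply/implyP/H.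
Qed.

Lemma inside_id x : inside x x = setT.
Proof. by apply/setP=> v; rewrite [RHS]inE; apply/insideP => c _; rewrite side_id ?inE. Qed.

(** The nodes whose bags hold [v] form a connected subtree, and its only way out of the side is the
    edge [xy]. *)
Lemma bag_crossing x y v a b : e x y -> v \in bag a -> a \in side e x y ->
  v \in bag b -> b \notin side e x y -> v \in bag x /\ v \in bag y.
Proof.
move=> exy va ax vb bx; case: dec => _ _ _ /(_ v a b va vb) ab.
suff [/(negP bx) //|//] : b \in side e x y \/ (v \in bag x /\ v \in bag y).
move: ab; apply: (connect_invariant (P := fun b => b \in side e x y \/
  (v \in bag x /\ v \in bag y))) => [|c d _ /and3P[ecd vc vd] [cx|]]; [by left| |by right].
have [dx|dx] := boolP (d \in side e x y); first by left.
by have [<- <-] := side_crossing tree_e exy ecd cx dx; right.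
Qed.

(** The bag that holds the whole edge lies in the side because of the inner end. The outer end is in
    that bag and in one off the side, hence in both bags at [xy]. *)
Lemma boundary_inside x y :
  e x y -> boundary (inside x y) \subset [set i | ends i :&: (bag x :&: bag y) != set0].
Proof.
move=> exy; apply/subsetP=> i /boundaryP[v [u [vi /insideP vin ui uout]]].
case: dec => _ _ /(_ i)[c ic] _; have vc := subsetP ic _ vi; have uc := subsetP ic _ ui.
have cx := vin c vc.
have /existsP[b /andP[ub bx]] : [exists b, (u \in bag b) && (b \notin side e x y)].
  apply: contraR uout; rewrite negb_exists => /forallP out.
  by apply/insideP=> b ub; have := out b; rewrite ub negbK.
have [ux uy] := bag_crossing exy uc cx ub bx.
by rewrite inE; apply/set0Pn; exists u; rewrite !inE ui ux.
Qed.

Lemma boundary_le (W : {set vertex G}) x : boundary W \subset [set i | ends i :&: bag x != set0] ->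
  #|boundary W| <= K.
Proof. by move=> /subset_leq_card /leq_trans; apply. Qed.

Lemma inside_child x y z : e x z -> z != y -> inside z x \subset inside x y :\: bag x.
Proof.
move=> exz zy; have ezx : e z x by rewrite e_sym.
apply/subsetP=> v /insideP vin; rewrite inE; apply/andP; split.
  by apply/negP=> /vin; apply/negP/bridge.
apply/insideP=> c /vin cz.
by have := subsetP (side_child tree_e exz zy) _ cz; rewrite in_setD1 => /andP[].
Qed.

Lemma inside_disjoint x z z' : e x z -> e x z' -> z != z' ->
  [disjoint inside z x & inside z' x].
Proof.
move=> exz exz' zz'; rewrite disjoint_subset; apply/subsetP=> v /insideP vz.
rewrite inE; apply/negP => /insideP vz'.
case: dec => _ /(_ v)[c vc] _ _.
by have := disjointFr (side_disjoint tree_e exz exz' zz') (vz c vc); rewrite vz'.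
Qed.

Lemma inside_children x y v : v \in inside x y -> v \notin bag x ->
  exists z, [/\ e x z, z != y & v \in inside z x].
Proof.
move=> /insideP vin vx; case: dec => _ /(_ v)[c vc] _ _.
have cx : c != x by apply: contraNneq vx => <-.
have [z [exz zy cz]] := side_children tree_e (vin c vc) cx.
exists z; split=> //; apply/insideP => b vb; apply: contraNT vx => bz.
have ezx : e z x by rewrite e_sym.
by have [] := bag_crossing ezx vc cz vb bz.
Qed.

(* The piece [U] is kept apart so that a path of tree nodes that meet no new tensor of [A]
   extends it instead of adding one piece per node. *)
Lemma inside_pieces x y : x = y \/ e x y -> inside x y :&: A != set0 ->
  exists U W n, [/\ inside x y = U :|: W, [disjoint U & W], [disjoint U & A],
    #|boundary W| <= K & disjoint_union good_piece W n /\
    n + 3 <= 5 * #|inside x y :&: A|].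
Proof.
have [k] := ubnP #|side e x y|; elim: k x y => // k IH x y; rewrite ltnS => lek xy nzA.
(* [Pos] holds the children whose part meets [A]. All that remains at [x] free of [A], in the bag
   and in the other children, is merged into the single set [W0], whose boundary edges all touch
   [bag x]. *)
pose Ch := [set z | e x z && (z != y)].
pose Pos := [set z in Ch | inside z x :&: A != set0].
pose B := inside x y :&: bag x.
pose W0 := (B :\: A) :|: \bigcup_(z in Ch :\: Pos) inside z x.
have ChP z : z \in Ch -> [/\ e x z, z != y & e z x].
  by rewrite inE => /andP[exz zy]; split; rewrite // e_sym.
have PosP z : z \in Pos -> z \in Ch by rewrite inE => /andP[].
have bd_inside z : z \in Ch -> boundary (inside z x) \subset [set i | ends i :&: bag x != set0].
  move=> /ChP[_ _ ezx]; apply: subset_trans (boundary_inside ezx) _.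
  by apply/subsetP=> i; rewrite !inE; apply: contraNneq => i0; rewrite setIA setIAC i0 set0I.
have bd_bag (S : {set vertex G}) : S \subset bag x ->
    boundary S \subset [set i | ends i :&: bag x != set0].
  move=> /subsetP Sx; apply/subsetP=> i /boundaryP[v [u [vi /Sx vx _ _]]].
  by rewrite inE; apply/set0Pn; exists v; rewrite inE vi.
have bd_cup (S : {set T}) : S \subset Ch ->
    boundary (\bigcup_(z in S) inside z x) \subset [set i | ends i :&: bag x != set0].
  move=> /subsetP SCh; apply/subsetP=> i /boundaryP[v [u [vi /bigcupP[z zS vz] ui uout]]].
  apply: (subsetP (bd_inside z (SCh z zS))); apply/boundaryP; exists v, u; split=> //.
  by apply: contra uout => uz; apply/bigcupP; exists z.
have bd_W0 : #|boundary W0| <= K.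
  apply: (@boundary_le _ x); apply: subset_trans (boundary_setU _ _) _.
  rewrite subUset bd_bag ?bd_cup ?subsetDl //.
  by apply: subset_trans (subsetDl _ _) _; apply: subsetIr.
have W0A : [disjoint W0 & A].
  rewrite -setI_eq0 setIUl setU_eq0; apply/andP; split.
    by rewrite setIDAC setDIl setDv setI0.
  rewrite -subset0; apply/subsetP=> v /setIP[/bigcupP[z]].
  rewrite in_setD => /andP[zP zC] vz vA; case/negP: zP.
  by rewrite inE zC; apply/set0Pn; exists v; rewrite in_setI vz.
have chD : forall z z', z \in Ch -> z' \in Ch -> z != z' -> [disjoint inside z x & inside z' x].
  by move=> z z' /ChP[exz _ _] /ChP[exz' _ _]; apply: inside_disjoint.
have cover : inside x y = W0 :|: (B :&: A :|: \bigcup_(z in Pos) inside z x).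
  apply/setP=> v; apply/idP/idP => [vin|].
    have [vx|vx] := boolP (v \in bag x).
      by rewrite !in_setU !in_setD !in_setI vin vx /=; case: (v \in A); rewrite ?orbT.
    have [z [exz zy vz]] := inside_children vin vx.
    have zC : z \in Ch by rewrite inE exz.
    have [zP|zP] := boolP (z \in Pos); rewrite !in_setU.
      by apply/orP; right; apply/orP; right; apply/bigcupP; exists z.
    by apply/orP; left; apply/orP; right; apply/bigcupP; exists z; rewrite // in_setD zP.
  have sub z : z \in Ch -> v \in inside z x -> v \in inside x y.
    by move=> /ChP[exz zy _] vz; have := subsetP (inside_child exz zy) _ vz;
      rewrite in_setD => /andP[].
  rewrite !in_setU => /orP[/orP[|/bigcupP[z]]|/orP[|/bigcupP[z /PosP zC]]].
  - by rewrite in_setD in_setI => /andP[_ /andP[]].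
  - by rewrite in_setD => /andP[_ zC]; apply: sub.
  - by rewrite in_setI in_setI => /andP[/andP[]].
  - exact: sub.
have notB z v : z \in Ch -> v \in inside z x -> v \in B = false.
  move=> /ChP[exz zy _] vz; have := subsetP (inside_child exz zy) _ vz.
  by rewrite in_setD in_setI => /andP[/negPf-> _]; rewrite andbF.
have disj0 : [disjoint W0 & B :&: A :|: \bigcup_(z in Pos) inside z x].
  rewrite disjoint_subset; apply/subsetP=> v vW0; apply/negP.
  move: vW0; rewrite /W0 => /setUP[|/bigcupP[z]].
    rewrite in_setD => /andP[vA vB]; rewrite in_setU in_setI (negPf vA) andbF /=.
    by move=> /bigcupP[z /PosP zC vz]; rewrite (notB z) in vB.
  rewrite in_setD => /andP[zP zC] vz; rewrite in_setU in_setI (notB z) //=.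
  move=> /bigcupP[z' z'P vz']; have zz' : z != z' by apply: contraNneq zP => ->.
  by have := disjointFr (chD _ _ zC (PosP _ z'P) zz') vz; rewrite vz'.
have disj1 : [disjoint B :&: A & \bigcup_(z in Pos) inside z x].
  rewrite disjoint_subset; apply/subsetP=> v /setIP[vB _].
  by apply/negP=> /bigcupP[z /PosP zC vz]; rewrite (notB z) in vB.
have gW0 : good_piece W0.
  by split; [rewrite -addnn; apply: leq_trans bd_W0 (leq_addr _ _)|left].
have IHz z : z \in Pos -> exists U W n, [/\ inside z x = U :|: W, [disjoint U & W],
    [disjoint U & A], #|boundary W| <= K & disjoint_union good_piece W n /\
    n + 3 <= 5 * #|inside z x :&: A|].
  rewrite inE => /andP[/ChP[exz zy ezx] nz]; apply: IH => //; last by right.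
  apply: leq_trans lek; rewrite [X in _ < X](cardsD1 x) side_refl add1n ltnS.
  exact: subset_leq_card (side_child tree_e exz zy).
have bd_xy : x = y \/ e x y -> #|boundary (inside x y)| <= K.
  case=> [<-|exy]; first by rewrite inside_id boundary_setT cards0.
  apply: (@boundary_le _ y); apply: subset_trans (boundary_inside exy) _.
  apply/subsetP=> i; rewrite !inE; apply: contraNneq => i0.
  by rewrite (setIC (bag x)) setIA i0 set0I.
have cardA : #|inside x y :&: A| = #|B :&: A| + \sum_(z in Pos) #|inside z x :&: A|.
  rewrite cover setIUl (disjoint_setI0 W0A) set0U setIUl -setIA setIid.
  have -> : (\bigcup_(z in Pos) inside z x) :&: A = \bigcup_(z in Pos) (inside z x :&: A).
    apply/setP=> v; rewrite in_setI; apply/andP/bigcupP => [[/bigcupP[z zP vz] vA]|[z zP]].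
      by exists z; rewrite // in_setI vz.
    by rewrite in_setI => /andP[vz vA]; split=> //; apply/bigcupP; exists z.
  rewrite cardsU -card_bigcup_disjoint; last first.
    move=> z z' /PosP zP /PosP zP' zz'; rewrite -setI_eq0 setIACA setIid.
    by rewrite (disjoint_setI0 (chD _ _ zP zP' zz')) set0I.
  rewrite -[RHS]subn0; congr (_ - _); apply/eqP; rewrite cards_eq0 setI_eq0.
  apply/bigcup_disjointP=> z zP; apply: disjointWr (bigcup_disjointP disj1 z zP).
  exact: subsetIl.
(* A node on a path: no vertex of [A] in [B] and only one child in [Pos]. Then [W0] joins the open
   set [U] of that child, while [W] and the count stay the same. *)
have [/andP[/eqP a0 P1]|] := boolP ((B :&: A == set0) && (#|Pos| == 1)).
  have [z defP] := cards1P P1.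
  have zP : z \in Pos by rewrite defP inE.
  have [U [W [n [zUW dUW UA bW [dW nW]]]]] := IHz z zP.
  have zUW0 : [disjoint W0 & U :|: W].
    by move: disj0; rewrite a0 set0U defP big_set1 zUW.
  move: zUW0; rewrite -setI_eq0 setIUr setU_eq0 !setI_eq0 => /andP[W0U W0W].
  exists (W0 :|: U), W, n; split=> //.
  - by rewrite cover a0 set0U defP big_set1 zUW setUA.
  - by rewrite -setI_eq0 setIUl setU_eq0 !setI_eq0 W0W.
  - by rewrite -setI_eq0 setIUl setU_eq0 !setI_eq0 W0A.
  - by split=> //; rewrite cardA a0 cards0 defP big_set1.
(* Elsewhere everything becomes pieces: one for [W0], one per vertex of [B :&: A], and one more than
   before for each child in [Pos]. A child has slack 3, spends 1 and leaves 2, so this inequality is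
   what restores the slack 3 at [x]. *)
move=> many; have a_Pos : 4 <= 4 * #|B :&: A| + #|Pos| * 2.
  rewrite negb_and -!cards_eq0 -!lt0n in many; case: (posnP #|B :&: A|) many => [a0|? _].
    rewrite a0 /= neq_ltn ltnS leqn0 => /orP[|]; last by lia.
    rewrite cards_eq0 => /eqP P0; case/negP: nzA.
    by rewrite -cards_eq0 cardA a0 P0 big_set0.
  by lia.
exists set0, (inside x y), (1 + (\sum_(v in B :&: A) 1 +
  \sum_(z in Pos) (5 * #|inside z x :&: A| - 2))).
split; rewrite ?set0U //.
- by rewrite disjoints_subset sub0set.
- by rewrite disjoints_subset sub0set.
- exact: bd_xy.
have g0 : good_piece set0.
  split; last by left; rewrite disjoints_subset sub0set.
  by rewrite boundary_set0 cards0.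
split.
  rewrite {1}cover; apply: disjoint_unionU disj0 (disjoint_union1 gW0) _.
  apply: disjoint_unionU disj1 _ _.
    have defBA : B :&: A = \bigcup_(v in B :&: A) [set v].
      apply/setP=> v; apply/idP/bigcupP => [vBA|[u uBA]]; first by exists v; rewrite ?set11.
      by rewrite inE => /eqP->.
    rewrite {1}defBA; apply: disjoint_union_bigcup => [u v _ _ uv|v /setIP[/setIP[_ vx] _]].
      by rewrite disjoints1 inE.
    apply: disjoint_union1; split; last by right; exists v.
    rewrite -addnn (leq_trans _ (leq_addr _ _)) //.
    by apply: boundary_le (bd_bag _ _); rewrite sub1set.
  apply: disjoint_union_bigcup => [z z' /PosP zP /PosP zP'|z zP]; first exact: chD.
  have [U [W [n [zUW dUW UA bW [dW nW]]]]] := IHz z zP.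
  (* The open set of the child is closed here; its boundary lies in those of [inside z x] and [W],
     whence the factor 2. *)
  have gU : good_piece U.
    split; last by left.
    apply: leq_trans (subset_leq_card (boundary_setUl dUW)) _.
    rewrite -zUW -addnn; apply: leq_trans (leq_card_setU _ _) (leq_add _ bW).
    exact: boundary_le (bd_inside _ (PosP _ zP)).
  apply: (@disjoint_unionW _ _ _ n.+1) => //; first by lia.
  by rewrite zUW; apply: DisjointUnionS.
have : \sum_(z in Pos) (5 * #|inside z x :&: A| - 2) + \sum_(z in Pos) 2 =
    5 * \sum_(z in Pos) #|inside z x :&: A|.
  rewrite -big_split /= big_distrr /=; apply: eq_bigr => z.
  by rewrite inE -cards_eq0 => /andP[_ nz]; lia.
by rewrite cardA !sum_nat_const muln1; lia.
Qed.

(** The induction is started at an arbitrary root with [y = x]; the open set left at the root is one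
    last piece. *)
Lemma vertex_pieces :
  exists n, n <= 5 * maxn 1 #|A| /\ disjoint_union good_piece [set: vertex G] n.
Proof.
have [T0 _ _ _] := tree_e; have /card_gt0P[x _] := T0.
have [A0|nzA] := eqVneq A set0.
  exists 1; split; first by lia.
  apply: disjoint_union1; split; first by rewrite boundary_setT cards0.
  by left; rewrite A0 disjoint_sym disjoints_subset sub0set.
have [] := @inside_pieces x x (or_introl erefl); rewrite inside_id setTI //.
move=> U [W [n [UW dUW UA bW [dW nW]]]]; exists n.+1.
split; first by lia.
rewrite UW; apply: (DisjointUnionS _ dUW dW); split; last by left.
apply: leq_trans (subset_leq_card (boundary_setUl dUW)) _.
by rewrite -UW boundary_setT set0U -addnn (leq_trans bW) ?leq_addr.
Qed.
End Pieces.

Local Open Scope ring_scope.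

(** * Partial contractions *)

Section PartialSums.
Variables (E P : finType) (K : comPzRingType).
Implicit Types (J : {set E}) (s w : {ffun E -> P}) (F : {ffun E -> P} -> K).

Definition agree_off J s w := [forall i, (i \notin J) ==> (w i == s i)].

Lemma agree_offP J s w :
  reflect (forall i, i \notin J -> w i = s i) (agree_off J s w).
Proof.
apply: (iffP forallP) => H i; first by move=> iJ; apply/eqP; have := H i; rewrite iJ.
by apply/implyP => /H->.
Qed.

(** Assignments are total on [E]: a tensor with fewer indices is a function that is [indep] of the
    others, so every contraction is a sum of this one form. *)
Definition psum J F s : K := \sum_(w | agree_off J s w) F w.

Definition indep J F : Prop := forall s w, agree_off J s w -> F w = F s.

Lemma indepS J J' F : J' \subset J -> indep J F -> indep J' F.
Proof.
move=> /subsetP JJ' iF s w /agree_offP sw; apply: iF; apply/agree_offP => i iJ.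
by apply: sw; apply: contra iJ => /JJ'.
Qed.

Lemma eq_psum J F F' s : F =1 F' -> psum J F s = psum J F' s.
Proof. by move=> eqF; apply: eq_bigr => w _; rewrite eqF. Qed.

Definition patch J s w : {ffun E -> P} := [ffun i => if i \in J then w i else s i].

Lemma psum0 F s : psum set0 F s = F s.
Proof.
rewrite /psum (big_pred1 s) // => w.
apply/agree_offP/eqP => [sw|-> //]; apply/ffunP => i; apply: sw.
by rewrite inE.
Qed.

Lemma psumU J J' F s : [disjoint J & J'] ->
  psum (J :|: J') F s = psum J (psum J' F) s.
Proof.
move=> dJ; rewrite /psum (partition_big (patch J s) (agree_off J s)) => [|w _]; last first.
  by apply/agree_offP => i iJ; rewrite ffunE (negPf iJ).
apply: eq_bigr => u /agree_offP su; apply: eq_bigl => w.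
apply/andP/agree_offP => [[/agree_offP sw /eqP <-] i iJ'|uw].
  by rewrite ffunE; case: ifPn => // iJ; rewrite sw // inE negb_or iJ.
split.
  apply/agree_offP => i; rewrite inE negb_or => /andP[iJ iJ'].
  by rewrite uw // su.
apply/eqP/ffunP => i; rewrite ffunE; case: ifPn => [iJ|iJ]; last by rewrite su.
by apply: uw; rewrite (disjointFr dJ iJ).
Qed.

Lemma psumMl J (g : {ffun E -> P} -> K) F s : indep J g ->
  psum J (fun w => g w * F w) s = g s * psum J F s.
Proof. by move=> ig; rewrite /psum big_distrr; apply: eq_bigr => w /ig ->. Qed.

Lemma psumMr J (g : {ffun E -> P} -> K) F s : indep J g ->
  psum J (fun w => F w * g w) s = psum J F s * g s.
Proof.
by move=> ig; rewrite mulrC -psumMl //; apply: eq_psum => w; rewrite mulrC.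
Qed.

Lemma indep_psum J J' F : indep J F -> indep (J :|: J') (psum J' F).
Proof.
move=> iF s s' /agree_offP ss'.
rewrite /psum (reindex_onto (patch J' s') (patch J' s)); last first.
  move=> w /agree_offP sw; apply/ffunP => i; rewrite !ffunE.
  by have [//|iJ'] := boolP (i \in J'); rewrite sw.
apply: eq_big => w.
  apply/andP/agree_offP => [[_ /eqP <-] i iJ'|sw]; first by rewrite ffunE (negPf iJ').
  split; first by apply/agree_offP => i iJ'; rewrite ffunE (negPf iJ').
  by apply/eqP/ffunP => i; rewrite !ffunE; have [//|iJ'] := boolP (i \in J'); rewrite sw.
move=> /andP[_ /eqP ww]; apply: iF; apply/agree_offP => i iJ; rewrite ffunE.
case: ifPn => // iJ'; rewrite -ww ffunE (negPf iJ') ss' //.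
by rewrite inE negb_or iJ.
Qed.

End PartialSums.

(** * Contractions of sets of tensors *)

Section TensorSum.
Variables (G : mgraph) (P : finType) (K : comPzRingType).
Variable g : vertex G -> {ffun edge G -> P} -> K.
Hypothesis g_local : forall v, indep [set i | v \notin ends i] (g v).
Hypothesis ends0 : forall i : edge G, ends i != set0.

Definition inner (W : {set vertex G}) : {set edge G} := [set i | ends i \subset W].

Definition tsum (W : {set vertex G}) := psum (inner W) (fun w => \prod_(v in W) g v w).

Lemma indep_prod (W : {set vertex G}) :
  indep [set i | [disjoint ends i & W]] (fun w => \prod_(v in W) g v w).
Proof.
move=> s w /agree_offP sw; apply: eq_bigr => v vW; apply: g_local.
apply/agree_offP => i; rewrite inE negbK => vi; apply: sw; rewrite inE.
by apply/negP=> /disjointFr/(_ vi); rewrite vW.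
Qed.

(** An index off the boundary is either summed or touches no tensor of [W]. So the contracted piece
    has at most [#|P| ^ #|boundary W|] different entries. *)
Lemma indep_tsum (W : {set vertex G}) : indep (~: boundary W) (tsum W).
Proof.
apply: (indepS _ (indep_psum (J' := inner W) (@indep_prod W))).
apply/subsetP=> i; rewrite !inE negb_and !negbK.
by rewrite -setI_eq0.
Qed.

Lemma inner_disjoint (U W : {set vertex G}) i : [disjoint U & W] ->
  i \in inner U -> [disjoint ends i & W].
Proof. by rewrite inE => dUW iU; apply: disjointWl iU dUW. Qed.

Lemma inner_indep (U W : {set vertex G}) : [disjoint U & W] ->
  inner U \subset ~: boundary W.
Proof.
move=> dUW; apply/subsetP=> i /(inner_disjoint dUW) di.
by rewrite !inE -setI_eq0 in di *; rewrite di.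
Qed.

Lemma tsum0 s : tsum set0 s = 1.
Proof.
rewrite /tsum (_ : inner set0 = set0) ?psum0 ?big_set0 //.
by apply/setP=> i; rewrite !inE subset0 (negPf (ends0 i)).
Qed.

(** An index inner to one set does not occur in the other, so both inner sums factor out; what
    remains to be summed are the indices joining the two sets. *)
Lemma tsumU (U W : {set vertex G}) s : [disjoint U & W] ->
  tsum (U :|: W) s =
  psum (inner (U :|: W) :\: (inner U :|: inner W)) (fun w => tsum U w * tsum W w) s.
Proof.
move=> dUW; have dWU : [disjoint W & U] by rewrite disjoint_sym.
have sub : inner U :|: inner W \subset inner (U :|: W).
  apply/subsetP=> i; rewrite !inE => /orP[] /subset_trans; apply; first exact: subsetUl.
  exact: subsetUr.
have dI : [disjoint inner U & inner W].
  rewrite disjoint_subset; apply/subsetP=> i iU; rewrite !inE.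
  apply: contra (ends0 i) => iW; rewrite -(setIidPl iW) setI_eq0.
  exact: inner_disjoint dUW iU.
rewrite {1}/tsum -{1}(setID (inner (U :|: W)) (inner U :|: inner W)) (setIidPr sub) setUC.
rewrite psumU; last by rewrite -setI_eq0 setIDAC setDIl setDv setI0.
apply: eq_psum => w; rewrite psumU // /tsum.
rewrite -psumMr; last exact: indepS (inner_indep dUW) (@indep_tsum W).
apply: eq_psum => u.
rewrite -(psumMl (g := fun t => \prod_(v in U) g v t)); last first.
  by apply: (indepS _ (@indep_prod U)); apply/subsetP=> i /(inner_disjoint dWU); rewrite inE.
apply: eq_psum => t; rewrite -bigU //=.
by apply: eq_bigl => v; rewrite !inE.
Qed.

End TensorSum.

(** * Sign patterns of real polynomials *)

(** Polynomial functions of total degree at most [D]; a monomial is a word in the variables.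
    [PolyfunEq] makes this a property of the function, whatever expression defines it. *)
Inductive polyfun (K : pzRingType) (I : Type) : nat -> ((I -> K) -> K) -> Prop :=
  | PolyfunWord D (w : seq I) :
      (size w <= D)%N -> polyfun D (fun x => \prod_(i <- w) x i)
  | PolyfunLin D c g h :
      polyfun D g -> polyfun D h -> polyfun D (fun x => c * g x + h x)
  | PolyfunEq D g h : polyfun D g -> g =1 h -> polyfun D h.

Section Polyfun.
Variables (K : comNzRingType) (I : Type).
Implicit Types (g h : (I -> K) -> K) (D : nat).

Lemma polyfun1 D : polyfun D (fun _ : I -> K => 1).
Proof.
by apply: (PolyfunEq (PolyfunWord K (leq0n D : (size [::] <= D)%N))) => x; rewrite big_nil.
Qed.

Lemma polyfun0 D : polyfun D (fun _ : I -> K => 0).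
Proof.
by apply: (PolyfunEq (PolyfunLin (-1) (polyfun1 D) (polyfun1 D))) => x; rewrite mulr1 addNr.
Qed.

Lemma polyfunZ D c g : polyfun D g -> polyfun D (fun x => c * g x).
Proof. by move=> gD; apply: (PolyfunEq (PolyfunLin c gD (polyfun0 D))) => x; rewrite addr0. Qed.

Lemma polyfunC D (c : K) : polyfun D (fun _ : I -> K => c).
Proof. by apply: (PolyfunEq (polyfunZ c (polyfun1 D))) => x; rewrite mulr1. Qed.

Lemma polyfunD D g h : polyfun D g -> polyfun D h -> polyfun D (fun x => g x + h x).
Proof. by move=> gD hD; apply: (PolyfunEq (PolyfunLin 1 gD hD)) => x; rewrite mul1r. Qed.

Lemma polyfunB D g h : polyfun D g -> polyfun D h -> polyfun D (fun x => g x - h x).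
Proof. by move=> gD hD; apply: (PolyfunEq (PolyfunLin (-1) hD gD)) => x; rewrite mulN1r addrC. Qed.

Lemma polyfunX (i : I) : polyfun 1 (fun x : I -> K => x i).
Proof.
by apply: (PolyfunEq (PolyfunWord K (isT : (size [:: i] <= 1)%N))) => x; rewrite big_seq1.
Qed.

Lemma polyfunW D D' g : (D <= D')%N -> polyfun D g -> polyfun D' g.
Proof.
move=> + gD; elim: gD D' => {D g} [D w wD|D c g h _ IHg _ IHh|D g h _ IHg eq_gh] D' DD'.
- exact: PolyfunWord (leq_trans wD DD').
- exact: PolyfunLin (IHg _ DD') (IHh _ DD').
- exact: PolyfunEq (IHg _ DD') eq_gh.
Qed.

Lemma polyfunM D D' g h :
  polyfun D g -> polyfun D' h -> polyfun (D + D') (fun x => g x * h x).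
Proof.
move=> gD hD'; elim: gD => {D g} [D w wD|D c g g' _ IHg _ IHg'|D g g' _ IHg eq_g]; last 1 first.
- by apply: (PolyfunEq IHg) => x; rewrite eq_g.
- elim: hD' => {D' h} [D' w' wD'|D' c g g' _ IHg _ IHg'|D' g g' _ IHg eq_g].
  + have wwD : (size (w ++ w') <= D + D')%N by rewrite size_cat leq_add.
    by apply: (PolyfunEq (PolyfunWord K wwD)) => x; rewrite big_cat.
  + by apply: (PolyfunEq (PolyfunLin c IHg IHg')) => x; rewrite mulrDr mulrCA.
  + by apply: (PolyfunEq IHg) => x; rewrite eq_g.
- by apply: (PolyfunEq (PolyfunLin c IHg IHg')) => x; rewrite mulrDl mulrA.
Qed.

Lemma polyfunXn D g n : polyfun D g -> polyfun (n * D) (fun x => g x ^+ n).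
Proof.
move=> gD; elim: n => [|n IH]; first by apply: PolyfunEq (polyfun1 _) _ => x; rewrite expr0.
by rewrite mulSn; apply: PolyfunEq (polyfunM gD IH) _ => x; rewrite exprS.
Qed.

Lemma polyfun_sum D (J : Type) (s : seq J) (P : pred J) (g : J -> (I -> K) -> K) :
  (forall j, polyfun D (g j)) -> polyfun D (fun x => \sum_(j <- s | P j) g j x).
Proof.
move=> gD; elim: s => [|j s IH].
  by apply: PolyfunEq (polyfun0 D) _ => x; rewrite big_nil.
have [Pj|nPj] := boolP (P j).
  by apply: PolyfunEq (polyfunD (gD j) IH) _ => x; rewrite big_cons Pj.
by apply: PolyfunEq IH _ => x; rewrite big_cons (negPf nPj).
Qed.

Lemma polyfun_prod D (J : Type) (s : seq J) (g : J -> (I -> K) -> K) :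
  (forall j, polyfun D (g j)) -> polyfun (size s * D) (fun x => \prod_(j <- s) g j x).
Proof.
move=> gD; elim: s => [|j s IH] /=.
  by apply: PolyfunEq (polyfun1 _) _ => x; rewrite big_nil.
by rewrite mulSn; apply: PolyfunEq (polyfunM (gD j) IH) _ => x; rewrite big_cons.
Qed.

End Polyfun.

Lemma polyfun_reindex (K : pzRingType) (I J : Type) (f : I -> J) D
    (g : (I -> K) -> K) :
  polyfun D g -> polyfun D (fun x => g (x \o f)).
Proof.
elim=> {D g} [D w wD|D c g h _ IHg _ IHh|D g h _ IHg eq_gh].
- have mwD : (size (map f w) <= D)%N by rewrite size_map.
  by apply: (PolyfunEq (PolyfunWord K mwD)) => x; rewrite big_map.
- exact: PolyfunLin.
- by apply: (PolyfunEq IHg) => x.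
Qed.

(** * Counting solutions of a triangular-free system with leading powers *)

Section Counting.
Variables (K : fieldType) (p N S : nat) (z : 'I_S -> 'I_p -> K).
Hypothesis z_inj : injective (fun s => [ffun i => z s i]).
Variable G : 'I_p -> ('I_p -> K) -> K.
Hypothesis N0 : (0 < N)%N.
Hypothesis GN : forall i, polyfun N.-1 (G i).
Hypothesis zG : forall s i, z s i ^+ N = G i (z s).

Let ex := {ffun 'I_p -> 'I_N}.
(** Each row evaluates one of the [N ^ p] monomials with all exponents below [N] at the [S]
    points. *)
Let M : 'M[K]_(#|{: ex}|, S) :=
  \matrix_(k, s) \prod_i z s i ^+ ((enum_val k : {ffun 'I_p -> 'I_N}) i : nat).
Let ev (g : ('I_p -> K) -> K) : 'rV[K]_S := \row_s g (z s).

Let prod_word (w : seq 'I_p) (x : 'I_p -> K) :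
  \prod_(i <- w) x i = \prod_i x i ^+ count_mem i w.
Proof.
elim: w => [|j w IH]; first by rewrite big_nil big1.
rewrite big_cons IH [in RHS](bigD1 j) //= eqxx exprS -mulrA; congr (_ * _).
rewrite [LHS](bigD1 j) //=; congr (_ * _); apply: eq_bigr => i ij.
by rewrite eq_sym (negPf ij).
Qed.

Let split_word (w : seq 'I_p) j (x : 'I_p -> K) :
  \prod_(i <- w) x i = x j ^+ count_mem j w * \prod_(i <- [seq i <- w | i != j]) x i.
Proof.
rewrite big_filter; elim: w => [|k w IH]; first by rewrite !big_nil mulr1.
rewrite !big_cons IH /=; have [->|kj] := eqVneq k j; first by rewrite exprS mulrA.
by rewrite mulrCA.
Qed.

(** Induction on the degree: in a word with at least [N] letters [j], the power [x j ^ N] may be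
    replaced at the points by [G j], of degree at most [N.-1], and the degree drops. *)
Let span D g : polyfun D g -> (ev g <= M)%MS.
Proof.
have [k] := ubnP D; elim: k D g => // k IH D g + gD.
elim: gD => {D g} [D w wD|D c g h _ IHg _ IHh|D g h _ IHg eq_gh] Dk.
- have [/forallP small|] := boolP [forall i, (count_mem i w < N)%N].
    pose m : ex := [ffun i => Ordinal (small i)].
    suff -> : ev (fun x => \prod_(i <- w) x i) = row (enum_rank m) M by exact: row_sub.
    apply/rowP=> s; rewrite !mxE prod_word enum_rankK.
    by apply: eq_bigr => i _; rewrite ffunE.
  rewrite negb_forall => /existsP[j]; rewrite -leqNgt => Nj.
  set c := count_mem j w in Nj; set w' := [seq i <- w | i != j].
  have szw : size w = (c + size w')%N by rewrite size_filter /c -(count_predC (pred1 j) w).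
  pose g (x : 'I_p -> K) := G j x * (x j ^+ (c - N) * \prod_(i <- w') x i).
  have -> : ev (fun x => \prod_(i <- w) x i) = ev g.
    apply/rowP=> s; rewrite !mxE (split_word w j) /g -/c -/w' -zG mulrA -exprD.
    by rewrite subnKC.
  have gD : polyfun (N.-1 + ((c - N) * 1 + size w')) g.
    apply: polyfunM (GN j) _; apply: polyfunM (polyfunXn _ (polyfunX _ _)) _.
    exact: PolyfunWord.
  by apply: IH gD; lia.
- have -> : ev (fun x => c * g x + h x) = c *: ev g + ev h by apply/rowP=> s; rewrite !mxE.
  by rewrite addmx_sub ?scalemx_sub ?IHg ?IHh.
- have -> : ev h = ev g by apply/rowP=> s; rewrite !mxE eq_gh.
  exact: IHg.
Qed.

(** Lagrange interpolation: each other point gives a linear factor in a coordinate where the two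
    points differ. *)
Let interp s : exists D g, polyfun D g /\ forall s', g (z s') = (s' == s)%:R.
Proof.
pose L s' (x : 'I_p -> K) :=
  if [pick j | z s j != z s' j] is Some j then (x j - z s' j) / (z s j - z s' j) else 1.
have L1 s' : polyfun 1 (L s').
  rewrite /L; case: pickP => [j _|_]; last exact: polyfun1.
  have lin := polyfunB (polyfunX K j) (polyfunC _ 1 (z s' j)).
  apply: PolyfunEq (polyfunZ (z s j - z s' j)^-1 lin) _.
  by move=> x; rewrite mulrC.
pose r := [seq s' <- enum 'I_S | s' != s].
exists (size r * 1)%N, (fun x => \prod_(s' <- r) L s' x); split; first exact: polyfun_prod.
move=> s'; have [->|s's] := eqVneq s' s.
  rewrite big1_seq // => s1 _; rewrite /L; case: pickP => // j zj.
  by rewrite divff // subr_eq0.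
rewrite (big_rem s') /=; last by rewrite mem_filter s's mem_enum.
rewrite {1}/L; case: pickP => [j _|noj]; first by rewrite subrr !mul0r.
case/eqP: s's; apply: z_inj; apply/ffunP=> j; rewrite !ffunE; apply/eqP.
by rewrite eq_sym; have /negbFE := noj j.
Qed.

(** By interpolation the rows of [M] span every unit vector, so [M] has rank [S], which is at most
    its number of rows. *)
Lemma card_box_zeros : (S <= N ^ p)%N.
Proof.
have <- : #|{: ex}| = (N ^ p)%N by rewrite card_ffun !card_ord.
suff full : row_full M by rewrite -(eqP full) rank_leq_row.
rewrite -sub1mx; apply/row_subP=> s; have [D [g [gD Hg]]] := interp s.
suff <- : ev g = row s 1%:M by exact: span gD.
by apply/rowP=> s'; rewrite !mxE Hg eq_sym.
Qed.
End Counting.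

(** * Partial derivatives of polynomial functions *)

Section Partial.
Variables (R : realType) (I : eqType).
Implicit Types (g : (I -> R) -> R) (x : I -> R) (i : I).

Definition translate x i (h : R) : I -> R := fun j => x j + (j == i)%:R * h.

(** A first-order expansion with quadratic error: it determines the derivative without limits and
    passes to sums and products by algebra. *)
Definition has_partial i g g' : Prop := forall x, exists C, forall h,
  `|h| <= 1 -> `|g (translate x i h) - g x - h * g' x| <= C * h ^+ 2.

Lemma has_partialX i j : has_partial i (fun x => x j) (fun => (j == i)%:R).
Proof.
move=> x; exists 0 => h _; rewrite /translate mul0r.
by rewrite (_ : _ - _ - _ = 0) ?normr0 //; ring.
Qed.

Lemma has_partialC i c : has_partial i (fun => c) (fun => 0).
Proof. by move=> x; exists 0 => h _; rewrite mulr0 subrr subr0 normr0 mul0r. Qed.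

Lemma has_partial_lin i c g g' k k' : has_partial i g g' -> has_partial i k k' ->
  has_partial i (fun x => c * g x + k x) (fun x => c * g' x + k' x).
Proof.
move=> pg pk x; have [C gC] := pg x; have [C' kC] := pk x.
exists (`|c| * C + C') => h h1.
have -> : c * g (translate x i h) + k (translate x i h) - (c * g x + k x) - h * (c * g' x + k' x) =
  c * (g (translate x i h) - g x - h * g' x) + (k (translate x i h) - k x - h * k' x) by ring.
apply: le_trans (ler_normD _ _) _; rewrite normrM mulrDl -mulrA.
by rewrite lerD ?kC // ler_wpM2l ?gC.
Qed.

Lemma has_partialM i g g' k k' : has_partial i g g' -> has_partial i k k' ->
  has_partial i (fun x => g x * k x) (fun x => g' x * k x + g x * k' x).
Proof.
move=> pg pk x; have [C gC] := pg x; have [C' kC] := pk x.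
exists (`|g' x * k' x| + (`|g x| + `|g' x|) * C' + (`|k x| + `|k' x| + C') * C) => h h1.
set eg := g (translate x i h) - g x - h * g' x.
set ek := k (translate x i h) - k x - h * k' x.
have eg_le : `|eg| <= C * h ^+ 2 by exact: gC.
have ek_le : `|ek| <= C' * h ^+ 2 by exact: kC.
have h2 : h ^+ 2 <= 1 by rewrite -(real_normK (num_real h)) expr_le1.
have C'0 : 0 <= C' by have := le_trans (normr_ge0 _) (kC 1 _); rewrite expr1n mulr1 normr1; apply.
have C0 : 0 <= C by have := le_trans (normr_ge0 _) (gC 1 _); rewrite expr1n mulr1 normr1; apply.
have -> : g (translate x i h) * k (translate x i h) - g x * k x - h * (g' x * k x + g x * k' x) =
  h ^+ 2 * (g' x * k' x) + (g x + h * g' x) * ek + (k x + h * k' x + ek) * eg.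
  by rewrite /eg /ek; ring.
have ek1 : `|ek| <= C' by apply: le_trans ek_le _; rewrite ler_piMr.
have lin (a b : R) : `|a + h * b| <= `|a| + `|b|.
  by apply: le_trans (ler_normD _ _) _; rewrite lerD2l normrM ler_piMl.
apply: le_trans (ler_normD _ _) _; rewrite [leRHS]mulrDl; apply: lerD; last first.
  rewrite normrM -mulrA; apply: ler_pM => //.
  exact: le_trans (ler_normD _ _) (lerD (lin _ _) ek1).
apply: le_trans (ler_normD _ _) _; rewrite [leRHS]mulrDl; apply: lerD.
  by rewrite normrM mulrC (ger0_norm (sqr_ge0 h)).
by rewrite normrM -mulrA; apply: ler_pM.
Qed.

Lemma has_partialXn i j n :
  has_partial i (fun x => x j ^+ n.+1) (fun x => (j == i)%:R * (n.+1%:R * x j ^+ n)).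
Proof.
elim: n => [|n IH] x.
  by have [C HC] := has_partialX i j x; exists C => h /HC; rewrite mulr1 mulr1.
have [C HC] := has_partialM (has_partialX i j) IH x; exists C => h /HC.
congr (_ <= _); congr (`| _ |); congr (_ - _ * _); rewrite !exprS.
by rewrite -[n.+2%:R]natr1; ring.
Qed.

Lemma has_partial_sum i (J : Type) (s : seq J) (g g' : J -> (I -> R) -> R) :
  (forall j, has_partial i (g j) (g' j)) ->
  has_partial i (fun x => \sum_(j <- s) g j x) (fun x => \sum_(j <- s) g' j x).
Proof.
move=> pg; elim: s => [|j s IH] x.
  by have [C HC] := has_partialC i 0 x; exists C => h /HC; rewrite !big_nil.
have [C HC] := has_partial_lin 1 (pg j) IH x; exists C => h /HC.
by rewrite !mul1r !big_cons.
Qed.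

Lemma polyfun_partial i D g : polyfun D g ->
  exists2 g', polyfun D.-1 g' & has_partial i g g'.
Proof.
elim=> {D g} [D w wD|D c g h _ [g' g'D pg] _ [h' h'D ph]|D g h _ [g' g'D pg] eq_gh].
(* As the predecessor truncates at 0, the derivative of the empty word has to be 0 itself; otherwise
   the product rule would only bound the degree for a one-letter word by 1. *)
- suff [g' [g'w _ pg]] : exists g', [/\ polyfun (size w).-1 g',
      size w = 0%N -> g' =1 (fun => 0) & has_partial i (fun x => \prod_(j <- w) x j) g'].
    by exists g' => //; apply: polyfunW g'w; rewrite -!subn1 leq_sub2r.
  elim: w {D wD} => [|j w [g' [g'w g'0 pg]]] /=.
    exists (fun => 0); split=> // [|x]; first exact: polyfun0.
    by have [C HC] := has_partialC i 1 x; exists C => h /HC; rewrite !big_nil.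
  exists (fun x => (j == i)%:R * (\prod_(k <- w) x k) + x j * g' x); split=> // [|x].
    apply: polyfunD; first exact/polyfunZ/PolyfunWord.
    have [w0|w0] := posnP (size w).
      by apply: PolyfunEq (polyfun0 _ _ _) _ => x; rewrite g'0 // mulr0.
    by rewrite -(prednK w0) -add1n; apply: polyfunM (polyfunX _ _) g'w.
  by have [C HC] := has_partialM (has_partialX i j) pg x; exists C => h /HC; rewrite !big_cons.
- exists (fun x => c * g' x + h' x); first exact: PolyfunLin.
  exact: has_partial_lin.
- exists g' => // x; have [C HC] := pg x; exists C => k /HC.
  by rewrite !eq_gh.
Qed.

(** A step of length [s] in the direction of the sign of the derivative [a] gains [s * |a|] up to an
    error of [C' * s ^ 2]; [s] is chosen so that the error is at most half of the gain. *)
Lemma partial_local_max i g g' x (d : R) : has_partial i g g' -> 0 < d ->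
  (forall h, `|h| < d -> g (translate x i h) <= g x) -> g' x = 0.
Proof.
move=> /(_ x)[C gC] d0 gmax; apply/eqP; apply: contraT => a0.
set a := g' x in a0 gC *; have na : 0 < `|a| by rewrite normr_gt0.
pose C' := `|C| + 1; have C'0 : 0 < C' by rewrite ltr_wpDl.
pose s := Num.min (d / 2) (Num.min 1 (`|a| / (2 * C'))).
have s0 : 0 < s by rewrite !lt_min ltr01 !divr_gt0 // mulr_gt0.
have sd2 : s <= d / 2 by rewrite ge_min lexx.
have sd : s < d by lra.
have s1 : s <= 1 by rewrite !ge_min lexx orbT.
have sa : C' * s <= `|a| / 2.
  have : s <= `|a| / (2 * C') by rewrite !ge_min lexx !orbT.
  by rewrite ler_pdivlMr ?mulr_gt0 // => ?; lra.
pose h := Num.sg a * s.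
have nh : `|h| = s by rewrite normrM normr_sg a0 mul1r gtr0_norm.
have := gC h; rewrite nh => /(_ s1); have := gmax h; rewrite nh => /(_ sd) gh.
have -> : h ^+ 2 = s ^+ 2 by rewrite -(real_normK (num_real h)) nh.
have -> : h * a = s * `|a| by rewrite normrEsg /h; ring.
have CC' : C <= C' by rewrite /C' (le_trans (ler_norm _)) // lerDl.
rewrite ler_norml => /andP[lo _].
have : s * `|a| <= C' * s ^+ 2 by have := ler_wpM2r (sqr_ge0 s) CC'; lra.
rewrite expr2 mulrCA ler_pM2l // => H; lra.
Qed.

End Partial.

(** * Critical points in the cells of a sign pattern *)

Section SignPatterns.
Import all_classical topology normedtype derive numFieldNormedType.Exports.
Variable R : realType.
Local Open Scope classical_set_scope.

Lemma polyfun_continuous p D (g : ('I_p -> R) -> R) :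
  polyfun D g -> continuous (fun x : 'rV[R]_p => g (x ord0)).
Proof.
elim=> {D g} [D w _|D c g h _ gC _ hC|D g h _ gC eq_gh] x.
- elim: w => [|j w IH].
    rewrite (_ : (fun _ => _) = (fun=> 1)); first exact: cst_continuous.
    by apply/funext=> y; rewrite big_nil.
  rewrite (_ : (fun _ => _) = (fun y : 'rV[R]_p => y ord0 j * \prod_(i <- w) y ord0 i)).
    by apply: continuousM IH; exact: coord_continuous.
  by apply/funext=> y; rewrite big_cons.
- by apply: continuousD (hC x); apply: continuousM (gC x); exact: cst_continuous.
- rewrite (_ : (fun _ => _) = (fun y : 'rV[R]_p => g (y ord0))); first exact: gC.
  by apply/funext=> y; rewrite eq_gh.
Qed.

Lemma polyfun_bound p D (g : ('I_p -> R) -> R) : polyfun D g ->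
  exists2 C, 0 <= C & forall (rho : R) x, 1 <= rho -> (forall i, `|x i| <= rho) ->
    `|g x| <= C * rho ^+ D.
Proof.
elim=> {D g} [D w wD|D c g h _ [C C0 gC] _ [C' C'0 hC]|D g h _ [C C0 gC] eq_gh].
- exists 1 => // rho x rho1 xr; rewrite mul1r.
  apply: le_trans (_ : rho ^+ size w <= _); last exact: ler_weXn2l.
  elim: w {wD} => [|j w IH]; first by rewrite big_nil normr1.
  by rewrite big_cons normrM exprS; apply: ler_pM.
- exists (`|c| * C + C') => [|rho x rho1 xr]; first by rewrite addr_ge0 ?mulr_ge0.
  apply: le_trans (ler_normD _ _) _; rewrite normrM mulrDl -mulrA.
  by apply: lerD; [rewrite ler_wpM2l ?gC|exact: hC].
- by exists C => // rho x rho1 xr; rewrite -eq_gh gC.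
Qed.

Section Maximum.
Variables (p : nat) (J : finType) (q : J -> ('I_p -> R) -> R) (D : nat).
Hypothesis qD : forall j, polyfun D (q j).
Variable eps : R.
Hypothesis eps0 : 0 < eps.

(** [N.-1] bounds the degree of [Q ^ 2], and [N.+1] is even, so the subtracted powers are
    nonnegative and outgrow [Q ^ 2]. *)
Let N := (2 * (#|J| * D)).+1.
Let Q x := \prod_(j : J) q j x.
Let F x := Q x ^+ 2 - eps * \sum_(i : 'I_p) x i ^+ N.+1.

Let QD : polyfun N.-1 (fun x => Q x ^+ 2).
Proof.
rewrite /N /=; apply: polyfunXn; apply: polyfunW (polyfun_prod _ qD).
by rewrite /index_enum -enumT -cardE.
Qed.

Let FD : polyfun N.+1 F.
Proof.
apply: polyfunB; first by apply: polyfunW QD; rewrite -ltnS ltnW.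
apply: polyfunZ; apply: polyfun_sum => i; rewrite -[X in polyfun X]muln1.
exact/polyfunXn/polyfunX.
Qed.

(** The cell is taken closed for the sake of compactness; strict inequalities are recovered at the
    maximum, where [F > 0] keeps [Q] from vanishing. *)
Let cell (sg : J -> R) := [set x : 'rV[R]_p | forall j, 0 <= sg j * q j (x ord0)].

(** On the faces of the cube, [Q ^ 2] is at most [C * rho ^ N.-1], while the subtracted term is at
    least [eps * rho ^ N.+1]; the latter wins once [rho >= 1] and [eps * rho > C]. *)
Let coercive : exists rho0 : R, forall rho, rho0 <= rho -> 1 <= rho /\
  forall x i, (forall j, `|x j| <= rho) -> `|x i| = rho -> F x < 0.
Proof.
have [C C0 QC] := polyfun_bound QD.
exists (1 + C / eps) => rho rho_ge.
have rho1 : 1 <= rho by apply: le_trans rho_ge; rewrite lerDl divr_ge0 // ltW.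
split=> // x i xr xi; rewrite subr_lt0; apply: le_lt_trans (ler_norm _) _.
apply: le_lt_trans (QC _ _ rho1 xr) _.
apply: lt_le_trans (_ : eps * rho ^+ N.+1 <= _); last first.
  rewrite ler_pM2l // (bigD1 i) //= -xi -normrX ger0_norm ?lerDl ?sumr_ge0 //.
    by move=> k _; rewrite exprn_even_ge0 // /N /= negbK mul2n odd_double.
  by rewrite exprn_even_ge0 // /N /= negbK mul2n odd_double.
have rho0 : 0 < rho by apply: lt_le_trans rho1.
have -> : rho ^+ N.+1 = rho ^+ 2 * rho ^+ N.-1 by rewrite -exprD add2n.
rewrite mulrA ltr_pM2r ?exprn_gt0 //.
apply: lt_le_trans (_ : eps * rho <= _); last first.
  by rewrite ler_pM2l // expr2 ler_peMl // ltW.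
apply: lt_le_trans (_ : eps * (1 + C / eps) <= _); last by rewrite ler_pM2l.
by rewrite mulrDr mulr1 mulrCA divff ?mulr1 ?ltrDr // gt_eqF.
Qed.

Let near0_lt (e : R) : 0 < e -> \forall h \near (0 : R), `|h| < e.
Proof. by move=> e0; apply/nbhs_ballP; exists e => //= h; rewrite /ball /= sub0r normrN. Qed.

Let near_pos (g : ('I_p -> R) -> R) D' (i : 'I_p) x : polyfun D' g -> 0 < g x ->
  \forall h \near (0 : R), 0 < g (translate x i h).
Proof.
move=> gD gx; have [g' _ pg] := polyfun_partial i gD; have [C HC] := pg x.
pose L := `|g' x| + `|C| + 1.
have L0 : 0 < L by rewrite ltr_wpDl // addr_ge0.
apply: filterS (filterI (near0_lt ltr01) (near0_lt (divr_gt0 gx L0))) => h [/ltW h1].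
rewrite ltr_pdivlMr // => hL.
have := HC h h1; rewrite ler_norml => /andP[+ _].
have : C * h ^+ 2 <= `|h| * `|C|.
  rewrite -(real_normK (num_real h)) expr2 mulrCA ler_wpM2l //.
  by apply: le_trans (ler_norm _) _; rewrite normrM normr_id ler_piMr.
have : - (h * g' x) <= `|h| * `|g' x| by rewrite -normrM -normrN ler_norm.
by rewrite /L !mulrDr mulr1 in hL *; have := normr_ge0 h; lra.
Qed.

(** [F] has a maximum on the part of the closed cell in a large cube, with value at least
    [F x0 > 0]. It is not on a face of the cube, where [F < 0], nor on a wall of the cell, where
    [Q = 0] and [F <= 0]; an interior maximum is critical. *)
Lemma cell_critical_point (sg : J -> R) x0 : (forall j, 0 < sg j * q j x0) -> 0 < F x0 ->
  exists z, (forall j, 0 < sg j * q j z) /\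
    forall i G, has_partial i F G -> G z = 0.
Proof.
move=> sg0 F0; have [rho0 Hrho] := coercive.
(* Large enough for coercivity and for the cube to contain [x0]. *)
pose rho := Num.max rho0 (\sum_i `|x0 i|).
have {Hrho}[rho1 Frho] : 1 <= rho /\
  forall x i, (forall j, `|x j| <= rho) -> `|x i| = rho -> F x < 0.
  by apply: Hrho; rewrite le_max lexx.
pose B := [set v : 'rV[R]_p | forall i, `[- rho, rho] (v ord0 i)].
have cB : compact B.
  by apply: (@rV_compact _ _ (fun=> `[- rho, rho]%classic)) => i; exact: segment_compact.
have BP v : B v <-> forall i, `|v ord0 i| <= rho.
  by split=> Bv i; have := Bv i; rewrite /= in_itv /= ler_norml.
have clC : closed (cell sg).
  rewrite (_ : cell sg = \bigcap_(j in setT)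
    ((fun v : 'rV[R]_p => sg j * q j (v ord0)) @^-1` [set y | 0 <= y])).
    apply: closed_bigI => j _; apply: preimage_closed; last exact: closed_ge.
    by move=> v _; apply: (polyfun_continuous (polyfunZ (sg j) (qD j))).
  by apply/seteqP; split=> v /= Hv j; [move=> _|]; apply: Hv.
have x0E : (\row_i x0 i) ord0 = x0 by apply/funext => i; rewrite mxE.
have Bx0 : (B `&` cell sg) (\row_i x0 i).
  split; last by move=> j; rewrite x0E ltW.
  apply/BP => i; rewrite x0E /rho le_max; apply/orP; right.
  by rewrite (bigD1 i) //= lerDl sumr_ge0.
have [z zS zmax] := EVT_max_rV (ex_intro _ _ Bx0) (compact_closedI cB clC)
  (continuous_subspaceT (polyfun_continuous FD)).
have {zS}[/BP zB zC] : (B `&` cell sg) z by rewrite inE in zS.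
have Fz : 0 < F (z ord0) by apply: lt_le_trans F0 _; rewrite -x0E zmax // inE.
have Qz : Q (z ord0) != 0.
  apply: contraTneq Fz => Qz; rewrite /F Qz expr0n sub0r -leNgt oppr_le0.
  apply: mulr_ge0; first exact: ltW.
  by apply: sumr_ge0 => i _; rewrite exprn_even_ge0 // /N /= negbK mul2n odd_double.
have zpos j : 0 < sg j * q j (z ord0).
  rewrite lt_neqAle zC andbT eq_sym mulf_neq0 //.
    by apply: contraTneq (sg0 j) => ->; rewrite mul0r ltxx.
  by move: Qz; rewrite /Q prodf_seq_neq0 => /allP/(_ j (mem_index_enum j)).
have zlt i : `|z ord0 i| < rho.
  rewrite lt_neqAle zB andbT; apply: contraTneq Fz => zi.
  by rewrite -leNgt ltW // (Frho _ i).
exists (z ord0); split=> // i G pG.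
have near_box : \forall h \near (0 : R), forall k, `|h| < rho - `|z ord0 k|.
  apply: (@filter_forall R _ (fun k h => `|h| < rho - `|z ord0 k|) (nbhs (0 : R)) _) => k.
  by apply: near0_lt; rewrite subr_gt0.
have near_cell : \forall h \near (0 : R), forall j, 0 < sg j * q j (translate (z ord0) i h).
  apply: (@filter_forall R _ (fun j h => 0 < sg j * q j (translate (z ord0) i h))
    (nbhs (0 : R)) _) => j.
  exact: near_pos (polyfunZ (sg j) (qD j)) (zpos j).
have : \forall h \near (0 : R), F (translate (z ord0) i h) <= F (z ord0).
  apply: filterS (filterI near_box near_cell) => h [hB hC].
  have hE : (\row_k translate (z ord0) i h k) ord0 = translate (z ord0) i h.
    by apply/funext => k; rewrite mxE.
  rewrite -hE; apply: zmax; rewrite inE; split.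
    apply/BP => k; rewrite hE; apply: le_trans (ler_normD _ _) _; rewrite normrM.
    have := zB k; have := hB k.
    by case: (k == i); rewrite ?normr1 ?normr0 ?mul1r ?mul0r; lra.
  by move=> j; rewrite hE ltW.
move=> /nbhs_ballP[d /= d0 dF].
apply: (partial_local_max pG d0) => h hd; apply: dF.
by rewrite /ball /= sub0r normrN.
Qed.
End Maximum.

(** Each pattern realised on the sample yields a critical point of [F] with the same signs. Distinct
    patterns thus give distinct points, which [card_box_zeros] counts. *)
Lemma card_sign_patterns p (J B : finType) (q : J -> ('I_p -> R) -> R) D
    (theta : B -> 'I_p -> R) :
  (forall j, polyfun D (q j)) -> (forall b j, q j (theta b) != 0) ->
  (#|[set [ffun j => (0 < q j (theta b))%R] | b : B]%SET| <= (2 * (#|J| * D)).+1 ^ p)%N.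
Proof.
move=> qD q0; set N := (2 * _).+1; set Pats := [set _ | b : B]%SET.
pose Q x := \prod_j q j x.
pose W b := \sum_(i : 'I_p) theta b i ^+ N.+1.
have W0 b : 0 <= W b.
  by apply: sumr_ge0 => i _; rewrite exprn_even_ge0 // /N /= negbK mul2n odd_double.
have Q0 b : 0 < Q (theta b) ^+ 2.
  by rewrite exprn_even_gt0 //= prodf_seq_neq0; apply/allP => j _; exact: q0.
(* One [eps] for the whole finite sample, so small that [F > 0] at every [theta b]. *)
pose eps := (1 + \sum_b W b / Q (theta b) ^+ 2)^-1.
have eps0 : 0 < eps.
  by rewrite invr_gt0 ltr_pwDl // sumr_ge0 // => b _; rewrite divr_ge0 // ltW.
have epsW b : eps * W b < Q (theta b) ^+ 2.
  rewrite mulrC /eps ltr_pdivrMr; last by rewrite -invr_gt0.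
  rewrite mulrC -ltr_pdivrMr // (bigD1 b) //= addrCA ltrDl ltr_pwDl //.
  by rewrite sumr_ge0 // => c _; rewrite divr_ge0 // ltW.
pose sg (s : {ffun J -> bool}) j : R := if s j then 1 else -1.
pose F x := Q x ^+ 2 - eps * \sum_(i : 'I_p) x i ^+ N.+1.
have crit (k : 'I_#|Pats|) : exists z, (forall j, 0 < sg (enum_val k) j * q j z) /\
    forall i G, has_partial i F G -> G z = 0.
  have /imsetP[b _ ->] := enum_valP k.
  apply: (cell_critical_point qD eps0) (theta b) _ _; last by rewrite subr_gt0 epsW.
  move=> j; rewrite /sg ffunE; case: (ltP 0 (q j (theta b))) => [|qle] /=; first by rewrite mul1r.
  by rewrite mulN1r oppr_gt0 lt_neqAle q0.
have [z zP] := choice crit.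
have sgP s j x : 0 < sg s j * q j x -> s j = (0 < q j x).
  rewrite /sg; case: (s j); first by rewrite mul1r => ->.
  by rewrite mulN1r oppr_gt0 => ?; apply/esym/negbTE; rewrite -leNgt ltW.
have Q2D : polyfun N.-1 (fun x => Q x ^+ 2).
  rewrite /N /=; apply: polyfunXn; apply: polyfunW (polyfun_prod _ qD).
  by rewrite /index_enum -enumT -cardE.
have HP i : exists H, polyfun N.-1 H /\ has_partial i (fun x => Q x ^+ 2) H.
  have [H HD pH] := polyfun_partial i Q2D; exists H; split=> //.
  exact: polyfunW (leq_pred _) HD.
have [H {}HP] := choice HP.
(* A critical point satisfies [H i x = eps * N.+1 * x i ^ N]; this constant solves it for
   [x i ^ N]. *)
pose c : R := (eps * N.+1%:R)^-1.
apply: (@card_box_zeros R p N #|Pats| z _ (fun i x => c * H i x)) => //.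
- move=> k k' zz; apply: enum_val_inj; apply/ffunP => j.
  have zkk' : z k = z k' by apply/funext => i; have /ffunP/(_ i) := zz; rewrite !ffunE.
  by rewrite (sgP _ _ _ ((zP k).1 j)) (sgP _ _ _ ((zP k').1 j)) zkk'.
- by move=> i; apply: polyfunZ; case: (HP i).
- move=> k i; have [_ crit_k] := zP k; have [_ pH] := HP i.
  have pS := has_partial_sum (index_enum 'I_p) (fun j => has_partialXn (R := R) i j N).
  have pF := has_partial_lin (- eps) pS pH.
  have FE : (fun x : 'I_p -> R => - eps * (\sum_i x i ^+ N.+1) + Q x ^+ 2) = F.
    by apply/funext=> x; rewrite /F mulNr addrC.
  rewrite FE in pF; have {pF} := crit_k i _ pF.
  rewrite (bigD1 i) //= big1 => [|j /negPf->]; last by rewrite mul0r.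
  rewrite eqxx mul1r addr0 mulNr mulrA => /eqP; rewrite addrC subr_eq0 => /eqP->.
  by rewrite mulrA mulVf ?mul1r // mulf_neq0 ?gt_eqF.
Qed.
End SignPatterns.

(** * Parametrization of networks *)

Section Representation.
Variables (R : rcfType) (G : mgraph) (P B A K : finType).
Variable chi : A -> K -> bool.
Variable g : B -> A -> vertex G -> {ffun edge G -> P} -> R[i].
Hypothesis g_local : forall b a v, indep [set i | v \notin ends i] (g b a v).
Hypothesis ends0 : forall i : edge G, ends i != set0.

(** The [chi] are fixed 0/1 functions of [a], which will be the assignment on [Y]; the assignment
    [b] off [Y] enters only through the coefficients. *)
Definition spanned_piece (U : {set vertex G}) : Prop :=
  forall s, exists coef : B -> K -> R[i],
    forall b a, tsum (g b a) U s = \sum_k coef b k * (chi a k)%:R.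

(* [theta b] lists the real parameters to which [b] fixes the pieces. *)
Definition parametrized (W : {set vertex G}) (D m : nat) : Prop :=
  exists (I : finType) (theta : B -> I -> R)
    (re im : A -> {ffun edge G -> P} -> (I -> R) -> R),
    [/\ (#|I| <= m)%N, forall a s, polyfun D (re a s), forall a s, polyfun D (im a s)
      & forall b a s, tsum (g b a) W s = Complex (re a s (theta b)) (im a s (theta b))].

(** Only the values of [s] on the boundary matter, so the parameters are the real and imaginary
    parts of one coefficient for each boundary assignment and each element of [K]. They enter
    linearly. *)
Lemma parametrized_piece (U : {set vertex G}) (q : nat) :
  (0 < #|P|)%N -> (#|boundary U| <= q)%N -> spanned_piece U ->
  parametrized U 1 (2 * (#|P| ^ q * #|K|)).
Proof.
move=> P0 Uq spanU; have [p0 _] := fintype.card_gt0P P0.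
pose cfg := {ffun {i : edge G | i \in boundary U} -> P}.
pose res (s : {ffun edge G -> P}) : cfg := [ffun i => s (val i)].
(* The default [p0] off the boundary is harmless by [indep_tsum]. *)
pose ext (c : cfg) : {ffun edge G -> P} :=
  [ffun i => if insub i is Some j then c j else p0].
have tsum_ext b a s : tsum (g b a) U s = tsum (g b a) U (ext (res s)).
  apply: (indep_tsum (g_local b a)) => //; apply/agree_offP => i.
  rewrite inE negbK => iU; rewrite ffunE; case: insubP => [j _ <-|]; last by rewrite iU.
  by rewrite ffunE.
have [coef coefP] := choice (fun c => spanU (ext c)).
pose I : finType := (bool * (cfg * K))%type.
pose theta b (i : I) := (if i.1 then @complex.Re R else @complex.Im R) (coef i.2.1 b i.2.2).
pose part e a s (x : I -> R) := \sum_k (chi a k)%:R * x (e, (res s, k)).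
exists I, theta, (part true), (part false).
have partP e a s : polyfun 1 (part e a s).
  by apply: polyfun_sum => k; apply/polyfunZ/polyfunX.
split=> //.
  rewrite !card_prod card_bool card_ffun card_sig leq_mul2l /= leq_mul2r.
  by rewrite leq_pexp2l ?orbT.
move=> b a s; rewrite tsum_ext coefP; apply/eqP; rewrite eq_complex /=.
by rewrite !raddf_sum /=; apply/andP; split; apply/eqP; apply: eq_bigr => k _; rewrite /theta /=;
  case: (chi a k); rewrite ?mulr1 ?mul1r ?mulr0 ?mul0r.
Qed.

(** By [tsumU] the contraction is a sum of products of the two parts. With separate parameters for
    each part, the real and imaginary parts of these products have degree at most [D + D']. *)
Lemma parametrizedU (U W : {set vertex G}) D m D' m' : [disjoint U & W] ->
  parametrized U D m -> parametrized W D' m' -> parametrized (U :|: W) (D + D') (m + m').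
Proof.
move=> dUW [I [th [re [im [Im reD imD UE]]]]] [I' [th' [re' [im' [Im' reD' imD' WE]]]]].
pose J := inner (U :|: W) :\: (inner U :|: inner W).
pose inr' (x : I + I' -> R) := x \o inr; pose inl' (x : I + I' -> R) := x \o inl.
exists (I + I')%type, (fun b i => match i with inl j => th b j | inr j => th' b j end),
 (fun a s x => \sum_(w | agree_off J s w)
   (re a w (inl' x) * re' a w (inr' x) - im a w (inl' x) * im' a w (inr' x))),
 (fun a s x => \sum_(w | agree_off J s w)
   (re a w (inl' x) * im' a w (inr' x) + im a w (inl' x) * re' a w (inr' x))).
have inlD n (h : (I -> R) -> R) : polyfun n h -> polyfun n (fun x => h (inl' x)).
  exact: polyfun_reindex.
have inrD n (h : (I' -> R) -> R) : polyfun n h -> polyfun n (fun x => h (inr' x)).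
  exact: polyfun_reindex.
split.
- by rewrite card_sum leq_add.
- by move=> a s; apply: polyfun_sum => w; apply: polyfunB; apply: polyfunM; auto.
- by move=> a s; apply: polyfun_sum => w; apply: polyfunD; apply: polyfunM; auto.
move=> b a s; rewrite tsumU // /psum -/J; apply/eqP; rewrite eq_complex /= !raddf_sum /=.
by apply/andP; split; apply/eqP; apply: eq_bigr => w _; rewrite UE WE.
Qed.

Lemma parametrized_union (W : {set vertex G}) (q n : nat) : (0 < #|P|)%N ->
  disjoint_union (fun U => (#|boundary U| <= q)%N /\ spanned_piece U) W n ->
  parametrized W n (n * (2 * (#|P| ^ q * #|K|))).
Proof.
move=> P0; elim=> {W n} [|U W n [Uq spanU] dUW _ IH].
  exists void, (fun _ => of_void R), (fun _ _ => fun=> 1), (fun _ _ => fun=> 0).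
  split; [by rewrite card_void| by move=> *; apply: polyfun1| by move=> *; apply: polyfun0|].
  by move=> b a s; rewrite tsum0.
by rewrite mulSn -add1n; apply: parametrizedU dUW (parametrized_piece P0 Uq spanU) IH.
Qed.
End Representation.

(** * From iterated contraction to a single sum *)

Section Contraction.
Variables (R : rcfType) (X : finType) (I : {fset nat}).
Implicit Types (g : tensor R X) (L : seq (tensor R X)) (w s : {ffun I -> Pi}).

Definition extend w (i : nat) : Pi :=
  if insub i is Some j then w j else (false, false).

Lemma extendE w (j : I) : extend w (val j) = w j.
Proof. by rewrite /extend valK. Qed.

Definition occurrences L (i : nat) := count (fun g => i \in idx g) L.

Definition contraction L := foldr (@contract R X) (unit_tensor R X) L.

Definition local_product L w :=
  \prod_(g <- L) entry (restr_idx (idx g) (extend w)).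

Lemma psum_shared (K : {fset nat}) (F : {ffun I -> Pi} -> xpoly R X) s :
  (K `<=` I)%fset ->
  psum [set i : I | val i \in K] F s =
  \sum_(u : {ffun K -> Pi}) F [ffun i : I => if insub (val i) is Some k then u k else s i].
Proof.
move=> /fsubsetP KI; pose h (u : {ffun K -> Pi}) : {ffun I -> Pi} :=
  [ffun i : I => if insub (val i) is Some k then u k else s i].
rewrite /psum (reindex_onto h (fun w => restr_idx K (extend w))); last first.
  move=> w /agree_offP sw; apply/ffunP => i; rewrite ffunE.
  case: insubP => [k iK ki|iK]; last by rewrite sw // inE.
  by rewrite ffunE ki extendE.
apply: eq_bigl => u; apply/andP; split.
  apply/agree_offP => i; rewrite inE => iK; rewrite ffunE.
  by case: insubP => // k; rewrite (negPf iK).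
apply/eqP/ffunP => k; rewrite ffunE -[val k]/(val (Sub (val k) (KI _ (valP k)) : I)).
by rewrite extendE ffunE /= valK.
Qed.

(** Contracting one more tensor [g] moves an index from no occurrence to one, or from one to two,
    and then it is summed. As no index occurs a third time, [g] is independent of the indices summed
    before and can be moved under their sum. *)
Lemma contractionP L : (forall i, 0 < occurrences L i -> i \in I)%N ->
  (forall i, occurrences L i <= 2)%N ->
  (forall i, (i \in idx (contraction L)) = (occurrences L i == 1%N)) /\
  forall s, entry (restr_idx (idx (contraction L)) (extend s)) =
    psum [set i : I | occurrences L (val i) == 2%N] (local_product L) s.
Proof.
elim: L => [|g L IH] LI L2.
  split=> [i|s]; first by rewrite inE.
  rewrite /psum (big_pred1 s) /local_product ?big_nil // => w.
  apply/agree_offP/eqP => [sw|-> //]; apply/ffunP => i; apply: sw.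
  by rewrite inE.
have occE i : occurrences (g :: L) i = ((i \in idx g) + occurrences L i)%N by [].
have [|i|idxF entryF] := IH.
- by move=> i iL; apply: LI; rewrite occE addn_gt0 iL orbT.
- by apply: leq_trans (L2 i); rewrite occE leq_addl.
set F := contraction L in idxF entryF *.
have FI : {subset idx F <= I}.
  by move=> i; rewrite idxF => /eqP iL; apply: LI; rewrite occE iL addn1.
have gI : {subset idx g <= I} by move=> i ig; apply: LI; rewrite occE ig.
pose K := (idx g `&` idx F)%fset.
pose D := ((idx g `\` idx F) `|` (idx F `\` idx g))%fset.
split=> [i|s].
  rewrite occE [contraction _]/= -/(contraction L) -/F [idx _]/= !inE idxF.
  have := L2 i; rewrite occE.
  by case: (i \in idx g); case: (occurrences L i) => [|[|[]]].
have KI : (K `<=` I)%fset by apply/fsubsetP=> i; rewrite inE => /andP[/gI].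
(* Inside [g] and [F], reading [s] on the free indices [D] and [u] on the shared indices [K] amounts
   to overwriting [s] by [u] on [K]. *)
have combineE (J : {fset nat}) (u : {ffun K -> Pi}) : {subset J <= I} ->
    {subset J <= [predU D & K]} ->
  restr_idx J (combine (restr_idx D (extend s)) u) =
  restr_idx J (extend [ffun i : I => if insub (val i) is Some k then u k else s i]).
  move=> JI JDK; apply/ffunP => j; rewrite !ffunE.
  have jI := JI _ (valP j); pose j' : I := Sub (val j) jI.
  have -> : extend [ffun i : I => if insub (val i) is Some k then u k else s i] (val j) =
      if insub (val j) is Some k then u k else s j'.
    by rewrite (extendE _ j') ffunE.
  rewrite /combine; case: insubP => [k kD kj|jD].
    rewrite ffunE kj; case: insubP => [k' k'K _|_]; last exact: (extendE s j').
    by move: kD k'K; rewrite !inE; case: (_ \in idx g); case: (_ \in idx F).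
  case: insubP => // jK.
  by have := JDK _ (valP j); rewrite inE /= (negPf jD) (negPf jK).
have gDK : {subset idx g <= [predU D & K]}.
  by move=> i ig; rewrite !inE ig /=; case: (i \in idx F).
have FDK : {subset idx F <= [predU D & K]}.
  by move=> i iF; rewrite !inE iF /=; case: (i \in idx g).
rewrite [contraction _]/= -/(contraction L) -/F [LHS]/=.
under eq_bigr do rewrite !combineE //.
rewrite -(psum_shared (fun w => entry (restr_idx (idx g) (extend w)) *
  entry (restr_idx (idx F) (extend w))) s KI).
set J2 := [set i : I | occurrences L (val i) == 2%N].
have dKJ : [disjoint [set i : I | val i \in K] & J2].
  rewrite disjoint_subset; apply/subsetP=> i; rewrite !inE => /andP[ig _].
  by apply/eqP=> i2; have := L2 (val i); rewrite occE ig i2.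
have -> : [set i : I | occurrences (g :: L) (val i) == 2%N] = [set i : I | val i \in K] :|: J2.
  apply/setP=> i; rewrite !inE idxF occE; have := L2 (val i); rewrite occE.
  by case: (_ \in idx g); case: (occurrences L _) => [|[|[]]].
rewrite psumU //; apply: eq_psum => w; rewrite entryF.
rewrite -(psumMl (g := fun w => entry (restr_idx (idx g) (extend w)))).
  by apply: eq_psum => u; rewrite /local_product big_cons.
move=> u v /agree_offP uv; congr entry; apply/ffunP => j; rewrite !ffunE.
rewrite -[val j]/(val (Sub (val j) (gI _ (valP j)) : I)) !extendE uv // inE.
by apply/eqP=> j2; have := L2 (val j); rewrite occE (valP j) j2.
Qed.
End Contraction.

Section Network.
Variables (R : rcfType) (X : finType) (m : nat) (N : m.-tuple (tensor R X)).
Hypothesis netN : is_network N.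

Lemma occurrencesE i : occurrences N i = #|[set v : 'I_m | i \in idx (tnth N v)]|.
Proof.
rewrite /occurrences -sum1_count big_tuple -sum1_card.
by apply: eq_bigl => v; rewrite inE.
Qed.

Lemma net_idxP i : reflect (exists v, i \in idx (tnth N v)) (i \in net_idx N).
Proof.
rewrite /net_idx big_tuple; apply: (iffP (bigfcupP _ _ _ _)) => [[v _ iv]|[v iv]].
  by exists v.
by exists v; rewrite // mem_index_enum.
Qed.

(** Every index occurs twice, so none is left free and all are summed, whatever [s] is. *)
Lemma net_polyE s : net_poly N = @tsum (net_graph N) Pi _
  (fun v w => entry (restr_idx (idx (tnth N v)) (extend (w : {ffun net_idx N -> Pi}))))
  [set: 'I_m] s.
Proof.
have occ i : occurrences N i = (if i \in net_idx N then 2 else 0)%N.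
  case: ifPn => [iN|iN]; first by rewrite occurrencesE; case: (netN (Sub i iN)).
  rewrite occurrencesE; apply/eqP; rewrite cards_eq0; apply/eqP/setP => v.
  by rewrite !inE; apply: contraNF iN => iv; apply/net_idxP; exists v.
have [i|i|idxN entryN] := @contractionP R X (net_idx N) N.
- by rewrite occ; case: ifP.
- by rewrite occ; case: ifP.
rewrite /net_poly -/(contraction N) (_ : [ffun=> _] = restr_idx _ (extend s)); last first.
  by apply/ffunP => i; have := valP i; rewrite idxN occ; case: ifP.
rewrite entryN /tsum; set J := [set i | _]; set J' := inner _.
have -> : J = J'.
  by apply/setP=> i; rewrite !inE subsetT occ (valP i).
apply: eq_psum => w; rewrite /local_product big_tuple.
by apply: eq_bigl => v; rewrite inE.
Qed.
End Network.

(** * Networks evaluated at Boolean points *)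

Section Evaluation.
Variables (R : realType) (X : finType) (m d : nat) (N : m.-tuple (tensor R X)).
Hypothesis netN : is_network N.
Hypothesis degN : (net_degree N <= d)%N.
Variable Y : {set X}.

Let Ysub : finType := {x : X | x \in Y}.
Let bits := {ffun X -> bool}.
Let Ybits := {ffun Ysub -> bool}.

Definition glue (b : bits) (a : Ybits) : bits :=
  [ffun x => if insub x is Some y then a y else b x].

Definition point (alpha : bits) (j : 'I_#|X|) : R[i] := (alpha (enum_val j))%:R.

Definition local_value (b : bits) (a : Ybits) (v : 'I_m) (w : {ffun net_idx N -> Pi}) : R[i] :=
  meval (point (glue b a)) (entry (restr_idx (idx (tnth N v)) (extend w))).

(* On bits, a monomial of degree at most [d] in the Y-variables is a product over a word of
   exactly [d] of them, repetitions allowed, or it is 1 (the case [None]). *)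
Definition word : finType := option {ffun 'I_d -> Ysub}.

Definition word_val (a : Ybits) (k : word) : bool :=
  if k is Some u then [forall j, a (u j)] else true.

Local Notation G := (net_graph N).

Lemma local_value_indep b a v :
  @indep (edge G) Pi _ [set i | v \notin ends i] (local_value b a v).
Proof.
move=> s w /agree_offP sw; congr (meval _ (entry _)); apply/ffunP => j; rewrite !ffunE.
have jN : val j \in net_idx N by apply/net_idxP; exists v; apply: valP.
rewrite -[val j]/(val (Sub (val j) jN : net_idx N)) !extendE sw //.
by rewrite !inE negbK; exact: (valP j).
Qed.

Lemma card_ends (i : edge G) : #|ends i| = 2%N.
Proof. by case: (netN i). Qed.

Lemma ends_neq0 (i : edge G) : ends i != set0.
Proof. by rewrite -cards_eq0 card_ends. Qed.

Lemma net_poly_eval b a s :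
  meval (point (glue b a)) (net_poly N) = @tsum G Pi _ (local_value b a) [set: 'I_m] s.
Proof.
rewrite (net_polyE netN s) /tsum /psum rmorph_sum /=.
by apply: eq_bigr => w _; rewrite rmorph_prod.
Qed.

(** Powers of a bit collapse, so on bits a monomial is the conjunction of its variables. *)
Lemma prod_bits (I : finType) (P : pred I) (c : I -> bool) (e : I -> nat) :
  \prod_(i | P i) ((c i)%:R : R[i]) ^+ e i =
  [forall (i | P i), (e i != 0%N) ==> c i]%:R.
Proof.
case: forall_inP => [all_c|/forall_inP].
  apply: big1 => i /all_c; case: eqP => [->|_ /= ->]; first by rewrite expr0.
  by rewrite expr1n.
rewrite negb_forall_in => /exists_inP[i Pi]; rewrite negb_imply => /andP[e0 /negPf ci].
by rewrite (bigD1 i) //= ci expr0n (negPf e0) mul0r.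
Qed.

(** The at most [d] variables of [Y] in the monomial are listed and padded to length [d] by
    repeating [y0]. If there are none, [None] is taken, since [Y] may be empty. *)
Lemma word_of_multinom (mu : multinom #|X|) : (mdeg mu <= d)%N ->
  exists k : word, forall b a, \prod_i point (glue b a) i ^+ mu i =
    (\prod_(i | enum_val i \notin Y) ((b (enum_val i))%:R : R[i]) ^+ mu i) * (word_val a k)%:R.
Proof.
move=> mu_d; pose S := [set y : Ysub | mu (enum_rank (val y)) != 0%N].
have S_d : (#|S| <= d)%N.
  apply: leq_trans mu_d; rewrite mdegE.
  pose rk (y : Ysub) := enum_rank (val y).
  rewrite -(card_imset S (f := rk)); last by move=> y z /enum_rank_inj /val_inj.
  apply: leq_trans (_ : #|[set i | mu i != 0%N]| <= _)%N.
    apply/subset_leq_card/subsetP=> _ /imsetP[y yS ->].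
    by rewrite inE in yS; rewrite inE.
  rewrite -sum1_card big_mkcond; apply: leq_sum => i _; rewrite inE.
  by case: (mu i).
have [k kP] : exists k : word, forall a, word_val a k = [forall y in S, a y].
  have [S0|[y0 y0S]] := set_0Vmem S.
    by exists None => a; apply/esym/forall_inP => y; rewrite S0 inE.
  exists (Some [ffun j : 'I_d => nth y0 (enum S) j]) => a.
  apply/forallP/forall_inP => [aS y yS|aS j].
    have yd : (index y (enum S) < d)%N.
      by apply: leq_trans S_d; rewrite cardE index_mem mem_enum.
    by have := aS (Ordinal yd); rewrite ffunE /= nth_index // mem_enum.
  rewrite ffunE; apply: aS; have [jS|jS] := ltnP j (size (enum S)).
    by rewrite -mem_enum mem_nth.
  by rewrite nth_default.
exists k => b a; rewrite (bigID (fun i => enum_val i \notin Y)) /=; congr (_ * _).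
  apply: eq_bigr => i iY; rewrite /point ffunE insubF //; exact: negPf.
rewrite kP [LHS](prod_bits _ (fun i => glue b a (enum_val i))); congr (_%:R).
congr nat_of_bool; apply/forall_inP/forall_inP => [aY y|aS i].
  rewrite inE => mu_y; have := aY (enum_rank (val y)).
  rewrite enum_rankK negbK (valP y) mu_y => /(_ isT); by rewrite ffunE valK.
rewrite negbK => iY; apply/implyP => mu_i; rewrite ffunE.
case: insubP => [y _ y_i|]; last by rewrite iY.
by apply: aS; rewrite inE y_i enum_valK.
Qed.

(** The degree bound is moved behind the existential quantifier so that a word can be chosen for all
    monomials at once. *)
Lemma word_of_bounded (mu : multinom #|X|) : exists k : word, (mdeg mu <= d)%N ->
  forall b a, \prod_i point (glue b a) i ^+ mu i =
    (\prod_(i | enum_val i \notin Y) ((b (enum_val i))%:R : R[i]) ^+ mu i) * (word_val a k)%:R.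
Proof.
have [/word_of_multinom[k kP]|mu_d] := boolP (mdeg mu <= d)%N; first by exists k.
by exists None.
Qed.

(** Every edge has two distinct ends, so nothing is summed; the coefficients group the monomials of
    the entry by their word. *)
Lemma spanned_single (v : 'I_m) :
  @spanned_piece R G Pi bits Ybits word word_val local_value [set v].
Proof.
move=> s; set p := entry (restr_idx (idx (tnth N v)) (extend s)).
have tsumE b a : @tsum G Pi _ (local_value b a) [set v] s = meval (point (glue b a)) p.
  rewrite /tsum (_ : inner _ = set0) ?psum0 ?big_set1 //; apply/setP=> i.
  rewrite !inE; apply/negP => /subset_leq_card.
  by have := card_ends i; rewrite /= cards1 => ->.
have p_d mu : mu \in msupp p -> (mdeg mu <= d)%N.
  move=> mu_p; apply: leq_trans degN; rewrite /net_degree big_tuple.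
  apply: leq_trans (leq_bigmax v); apply: leq_trans (leq_bigmax (restr_idx _ (extend s))).
  by rewrite /deg -ltnS (leq_trans (msize_mdeg_lt mu_p)) // leqSpred.
have [k kP] := choice (fun mu => word_of_bounded mu).
exists (fun (b : bits) k0 => \sum_(mu <- msupp p | k mu == k0)
  mcoeff mu p * \prod_(i | enum_val i \notin Y) ((b (enum_val i))%:R : R[i]) ^+ mu i) => b a.
rewrite tsumE mevalE (partition_big k xpredT) //=; apply: eq_bigr => k0 _.
rewrite big_distrl /=; rewrite [LHS]big_seq_cond [RHS]big_seq_cond.
apply: eq_bigr => mu /andP[mu_p /eqP <-].
by rewrite kP ?p_d // mulrA.
Qed.

(** The value does not depend on [a], so it is computed at an arbitrary [a0] and carried by the
    constant function [None]. *)
Lemma spanned_free (U : {set 'I_m}) : (forall v, v \in U -> ~~ Y_tensor Y (tnth N v)) ->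
  @spanned_piece R G Pi bits Ybits word word_val local_value U.
Proof.
move=> UY s; pose a0 : Ybits := [ffun=> false].
exists (fun b k => if k is Some _ then 0 else @tsum G Pi _ (local_value b a0) U s) => b a.
rewrite (bigD1 (None : word)) //= mulr1 big1 ?addr0 => [|[k|] // _]; last by rewrite mul0r.
apply: eq_bigr => w _; apply: eq_bigr => v vU.
rewrite /local_value !mevalE; apply: eq_big_seq => mu mu_p; congr (_ * _).
apply: eq_bigr => i _; rewrite /point !ffunE; case: insubP => // y yY y_i.
have [-> //|mu_i] := eqVneq (mu i) 0%N.
case/negP: (UY v vU); apply/existsP; exists (restr_idx _ (extend w)).
apply/exists_inP; exists (enum_val i); rewrite // -?y_i ?(valP y) //.
by apply/hasP; exists mu; rewrite // y_i enum_valK.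
Qed.

End Evaluation.

(** * Counting subfunctions *)

Section SubfunctionCount.
Variables (R : realType) (X : finType) (m : nat) (N : m.-tuple (tensor R X)).
Hypothesis netN : is_network N.
Local Notation G := (net_graph N).

Lemma incident_edges_le (S : {set 'I_m}) :
  (#|[set i : edge G | ends i :&: S != set0]| <= #|S| * net_rank N)%N.
Proof.
apply: leq_trans (_ : \sum_(v in S) #|[set i : edge G | v \in ends i]| <= _)%N.
  rewrite (eq_bigr (fun v : 'I_m => \sum_(i : edge G) (v \in ends i)))%N; last first.
    by move=> v _; rewrite -sum1_card big_mkcond; apply: eq_bigr => i _; rewrite inE; case: ifP.
  rewrite exchange_big -sum1_card big_mkcond /=; apply: leq_sum => i _.
  case: ifP => //; rewrite inE => /set0Pn[v /setIP[vi vS]].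
  by rewrite (bigD1 v) //= vi.
rewrite -sum_nat_const; apply: leq_sum => v _.
apply: leq_trans (_ : tensor_rank (tnth N v) <= _)%N; last first.
  by rewrite /net_rank big_tuple; apply: (leq_bigmax v).
rewrite cardE -(size_map val); apply: uniq_leq_size.
  by rewrite map_inj_uniq ?enum_uniq //; apply: val_inj.
by move=> _ /mapP[i + ->]; rewrite mem_enum !inE.
Qed.

(** A bag has at most [t.+1 <= 2 * t] tensors if [t > 0], each with at most [net_rank N] indices. If
    [t = 0], no bag can hold the two ends of an edge, so there are no edges. *)
Lemma net_pieces (t : nat) (A : {set 'I_m}) : has_treewidth G t ->
  exists n, (n <= 5 * maxn 1 #|A|)%N /\
    disjoint_union (@good_piece G (2 * (net_rank N * t)) A) [set: 'I_m] n.
Proof.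
move=> [[T [e [bag [dec wt]]]] _].
apply: (vertex_pieces dec) => x.
have bag_t : (#|bag x| <= t.+1)%N.
  by rewrite -wt /width; apply: leq_trans (leqSpred _); apply: (leq_bigmax x).
have [t0|t0] := posnP t; last first.
  apply: leq_trans (incident_edges_le (bag x)) _.
  have bag_2t : (#|bag x| <= 2 * t)%N by lia.
  by rewrite (mulnC (net_rank N)) mulnA leq_mul2r bag_2t orbT.
apply: leq_trans (_ : 0 <= _)%N => //; rewrite leqn0 cards_eq0; apply/eqP/setP => i.
case: dec => _ _ /(_ i)[y iy] _.
have := subset_leq_card iy; rewrite (card_ends netN).
have : (#|bag y| <= t.+1)%N.
  by rewrite -wt /width; apply: leq_trans (leqSpred _); apply: (leq_bigmax y).
by rewrite t0; case: #|bag y| => [|[]].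
Qed.

Lemma meval_map_Re n (p : mpoly n R[i]) (x : 'I_n -> R) :
  meval x (map_mpoly (@complex.Re R) p) = complex.Re (meval (fun i => real_complex R (x i)) p).
Proof.
rewrite [in RHS]mevalE /map_mpoly /mmap !raddf_sum; apply: eq_bigr => mu _.
have -> : \prod_i real_complex R (x i) ^+ mu i = real_complex R (\prod_i x i ^+ mu i).
  by rewrite rmorph_prod; apply: eq_bigr => i _; rewrite rmorphXn.
rewrite /= mevalM mevalC /mmap1 rmorph_prod /=; case: (mcoeff mu p) => a b /=.
rewrite mulr0 subr0; congr (_ * _).
by apply: eq_bigr => i _; rewrite rmorphXn /= mevalXU.
Qed.

Lemma meval_map_Im n (p : mpoly n R[i]) (x : 'I_n -> R) :
  meval x (map_mpoly (@complex.Im R) p) = complex.Im (meval (fun i => real_complex R (x i)) p).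
Proof.
rewrite [in RHS]mevalE /map_mpoly /mmap !raddf_sum; apply: eq_bigr => mu _.
have -> : \prod_i real_complex R (x i) ^+ mu i = real_complex R (\prod_i x i ^+ mu i).
  by rewrite rmorph_prod; apply: eq_bigr => i _; rewrite rmorphXn.
rewrite /= mevalM mevalC /mmap1 rmorph_prod /=; case: (mcoeff mu p) => a b /=.
rewrite mulr0 add0r; congr (_ * _).
by apply: eq_bigr => i _; rewrite rmorphXn /= mevalXU.
Qed.

Lemma net_value_sqr (alpha : {ffun X -> bool}) :
  net_value N alpha ^+ 2 =
  complex.Re (meval (point R alpha) (net_poly N)) ^+ 2 +
  complex.Im (meval (point R alpha) (net_poly N)) ^+ 2.
Proof.
have -> : point R alpha = fun i => real_complex R ((alpha (enum_val i))%:R).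
  by apply/funext => i; rewrite /point rmorph_nat.
rewrite -meval_map_Re -meval_map_Im sqr_sqrtr //.
by rewrite addr_ge0 ?sqr_ge0.
Qed.

(** The value of the subfunction of [b] at [a] is the sign at [theta b] of the polynomial belonging
    to [a]. There are [2 ^ #|Y|] polynomials, of degree at most [n + n], in the parameters of the
    [n] pieces. *)
Lemma nb_subfun_le (f : {ffun X -> bool} -> bool) (t : nat) (Y : {set X}) :
  has_treewidth G t -> computes N f ->
  exists n, (n <= 5 * maxn 1 (nb_Y_tensors N Y))%N /\
    (nb_subfun f Y <= (2 * (2 ^ #|Y| * (n + n))).+1 ^
      (n * (2 * (4 ^ (4 * (net_rank N * t)) * (#|Y| ^ net_degree N).+1))))%N.
Proof.
move=> tw comp; set d := net_degree N; set q := (4 * _)%N.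
pose A := [set v | Y_tensor Y (tnth N v)].
have cardA : #|A| = nb_Y_tensors N Y.
  rewrite /nb_Y_tensors -sum1_count big_tuple -sum1_card.
  by apply: eq_bigl => v; rewrite inE.
have [n [n5 pieces]] := net_pieces A tw; exists n; rewrite -cardA; split=> //.
pose bits := {ffun X -> bool}; pose Ybits := {ffun {x : X | x \in Y} -> bool}.
have Pi4 : #|Pi| = 4 by rewrite card_prod card_bool.
have {pieces} : disjoint_union (fun U => (#|boundary U| <= q)%N /\
    @spanned_piece R G Pi bits Ybits (word d Y) (@word_val X d Y)
      (@local_value R X m N Y) U) [set: 'I_m] n.
  apply: disjoint_union_impl pieces => U [Uq UA]; split.
    by apply: leq_trans Uq _; rewrite /q -mul2n mulnA.
  case: UA => [UA|[v ->]]; last exact: spanned_single.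
  by apply: spanned_free => // v vU; have := disjointFr UA vU; rewrite inE => ->.
move=> /(parametrized_union (@local_value_indep R X m N Y) (ends_neq0 netN)).
rewrite Pi4 card_option card_ffun card_ord => /(_ isT).
have -> : #|{: {x : X | x \in Y}}| = #|Y| by rewrite card_sig; apply: eq_card.
move=> [I [theta [re [im [cardI reD imD valE]]]]].
pose s0 : {ffun edge G -> Pi} := [ffun=> (false, false)].
(* Squaring turns the comparison of the value with 1/2 into a sign, which is never 0 because
   [computes] is strict. *)
pose qq a (x : I -> R) := re a s0 x ^+ 2 + im a s0 x ^+ 2 - 1 / 4.
have qqE b a : qq a (theta b) = net_value N (glue b a) ^+ 2 - 1 / 4.
  by rewrite /qq net_value_sqr (net_poly_eval netN b a s0) valE.
have comp_b b a : (0 < qq a (theta b)) = f (glue b a) /\ qq a (theta b) != 0.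
  have v0 : 0 <= net_value N (glue b a) by exact: sqrtr_ge0.
  rewrite qqE; have := comp (glue b a); set v := net_value N (glue b a) in v0 *.
  case: (f _) => v12.
    have : 0 < v ^+ 2 - 1 / 4 by nra.
    by move=> pos; rewrite pos gt_eqF.
  have neg : v ^+ 2 - 1 / 4 < 0 by nra.
  by rewrite lt_eqF //; split=> //; apply/negbTE; rewrite -leNgt ltW.
pose th b (j : 'I_#|I|) := theta b (enum_val j).
pose q' a (x : 'I_#|I| -> R) := qq a (x \o enum_rank).
have thE b : th b \o enum_rank = theta b by apply/funext => i; rewrite /th /= enum_rankK.
have q'D a : polyfun (n + n) (q' a).
  apply: (polyfun_reindex enum_rank); apply: polyfunB; last exact: polyfunC.
  by apply: polyfunD; apply: polyfunM.
have := card_sign_patterns (theta := th) q'D.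
rewrite /q' => /(_ _)/= count.
apply: leq_trans (_ : (2 * (2 ^ #|Y| * (n + n))).+1 ^ #|I| <= _)%N; last by rewrite leq_pexp2l.
have <- : #|{: Ybits}| = (2 ^ #|Y|)%N.
  by rewrite card_ffun card_bool card_sig; congr (_ ^ _)%N; apply: eq_card.
apply: leq_trans (count _); last by move=> b a; rewrite thE; case: (comp_b b a).
rewrite /nb_subfun; apply/eq_leq; congr #|pred_of_set _|.
apply: eq_imset => b; apply/ffunP => a; rewrite !ffunE thE.
by case: (comp_b b a) => -> _.
Qed.
End SubfunctionCount.

(** * The final estimate *)

Lemma pattern_bound_nat (y d q l n : nat) : (n <= 5 * maxn 1 l)%N ->
  ((2 * (2 ^ y * (n + n))).+1 ^ (n * (2 * (4 ^ (4 * q) * (y ^ d).+1))) <=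
   maxn 2 l ^ (2 ^ (16 * maxn 1 q) * maxn 1 y ^ d.+1 * maxn 2 l))%N.
Proof.
set L := maxn 2 l; set Y := maxn 1 y => n_le.
have L2 : (2 <= L)%N by rewrite leq_maxl.
have Y1 : (1 <= Y)%N by rewrite leq_maxl.
have nL : (n <= 5 * L)%N by lia.
have powL k : (2 ^ k <= L ^ k)%N by case: k => // k; rewrite leq_exp2r.
(* As [L >= 2], powers of 2 are absorbed into powers of [L]; here [4 * 5 + 1 <= 2 ^ 5]. *)
have base : ((2 * (2 ^ y * (n + n))).+1 <= L ^ (7 * Y))%N.
  apply: leq_trans (_ : L ^ (5 + (y + 1)) <= _)%N; last by rewrite leq_pexp2l //; lia.
  apply: leq_trans (_ : 2 ^ 5 * (2 ^ y * L) <= _)%N.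
    have Py : (0 < 2 ^ y)%N by rewrite expn_gt0.
    have PL : (0 < 2 ^ y * L)%N by rewrite muln_gt0 Py ltnW.
    have Pn : (2 ^ y * n <= 5 * (2 ^ y * L))%N by rewrite mulnCA leq_mul2l nL orbT.
    by rewrite mulnDr; lia.
  by rewrite !expnD expn1; apply: leq_mul (powL 5) (leq_mul (powL y) (leqnn L)).
apply: leq_trans (_ : (L ^ (7 * Y)) ^ (n * (2 * (4 ^ (4 * q) * (y ^ d).+1))) <= _)%N.
  by case: (n * _)%N => // k; rewrite leq_exp2r.
rewrite -expnM leq_pexp2l //; first by rewrite ltnW.
have yd : ((y ^ d).+1 <= 2 * Y ^ d)%N.
  have : (y ^ d <= Y ^ d)%N.
    by case: (d) => // k; rewrite leq_exp2r // leq_maxr.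
  have : (0 < Y ^ d)%N by rewrite expn_gt0 Y1.
  by lia.
(* The factor [140 = 7 * 5 * 2 * 2] collects the constants of the bounds on the base, on [n] and on
   [y ^ d + 1]. The maximum with 1 covers [q = 0]. *)
have q16 : (140 * 4 ^ (4 * q) <= 2 ^ (16 * maxn 1 q))%N.
  apply: leq_trans (_ : 2 ^ 8 * 2 ^ (8 * q) <= _)%N.
    by rewrite leq_mul // -[4%N]/(2 ^ 2)%N -expnM leq_pexp2l //; lia.
  by rewrite -expnD leq_pexp2l //; lia.
apply: leq_trans (_ : 7 * Y * (5 * L * (2 * (4 ^ (4 * q) * (2 * Y ^ d)))) <= _)%N.
  by rewrite !leq_mul.
apply: leq_trans (_ : 140 * 4 ^ (4 * q) * Y ^ d.+1 * L <= _)%N; last by rewrite !leq_mul.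
by apply: eq_leq; rewrite expnS; ring.
Qed.

(** The [maxn] settle the degenerate cases: [r * t = 0] would leave no room for the constant [c],
    and [#|Y| = 0] or [l <= 1] would make the exponent 0. *)
Theorem theorem3 (R : realType) :
  exists c : nat,
    forall (X : finType) (f : {ffun X -> bool} -> bool)
      (m : nat) (N : m.-tuple (tensor R X)) (t r d : nat),
      is_network N ->
      connected_mgraph (net_graph N) ->
      has_treewidth (net_graph N) t ->
      net_rank N = r ->
      net_degree N = d ->
      computes N f ->
      forall (Y : {set X}) (l : nat),
        nb_Y_tensors N Y = l ->
        ((nb_subfun f Y)%:R : R) <=
          expR (2 ^+ (c * maxn 1 (r * t)) * (maxn 1 #|Y|)%:R ^+ d.+1 *
                ((maxn 2 l)%:R * ln (maxn 2 l)%:R)).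
Proof.
exists 16%N => X f m N t r d netN _ tw rN dN comp Y l lN.
have [n [n_le count]] := nb_subfun_le netN Y tw comp.
rewrite rN dN lN in n_le count.
have bound := leq_trans count (pattern_bound_nat #|Y| d (r * t) n_le).
have L0 : 0 < (maxn 2 l)%:R :> R by rewrite ltr0n leq_max.
apply: le_trans (_ : ((maxn 2 l) ^
  (2 ^ (16 * maxn 1 (r * t)) * maxn 1 #|Y| ^ d.+1 * maxn 2 l))%:R <= _).
  by rewrite ler_nat.
by rewrite natrX -{1}(lnK L0) -expRM_natl !natrM !natrX !mulrA.
Qed.
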